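(* Let $\{X(s)\}_{s\ge 0}$ be a centered Gaussian process with continuous sample paths and covariance kernel $R(s,t)=\mathbb{E}[X(s)X(t)]$. Assume: (i) there exists $\rho>0$ such that $R(cs,ct)=c^{2\rho}R(s,t)$ for all $c>0$ and all $s,t>0$; (ii) there exists $\eta>0$ such that the function $h(x)=x^{-\rho}R(1,x)$, $x\ge 1$, satisfies $h(x)=O((\log x)^{-\eta})$ as $x\to\infty$. Then \[ \limsup_{s\to\infty}\pm\frac{X(s)}{\sqrt{2s^{2\rho}\log\log s}}=R(1,1)^{1/2}\quad\text{almost surely} \] (for both choices of sign). *)

(* Defs.v *)
From HB Require Import structures.
From mathcomp Require Import all_boot all_order all_algebra.
From mathcomp Require Import all_classical all_reals all_analysis.
Set Implicit Arguments. Unset Strict Implicit. Unset Printing Implicit Defensive.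
Import Order.TTheory GRing.Theory Num.Theory.
Import numFieldNormedType.Exports.
Local Open Scope classical_set_scope.
Local Open Scope ring_scope.

(* A real random variable Y is centered Gaussian if it is measurable and either
   its law is N(0, sigma^2) for some sigma > 0, or Y = 0 almost surely
   (degenerate Gaussian).  (normal_prob 0 0 is not the Dirac mass in the
   library, hence the separate degenerate case.) *)
Definition centered_gaussian_rv {d} {T : measurableType d} {R : realType}
  (P : probability T R) (Y : T -> R) : Prop :=
  measurable_fun setT Y /\
  ((exists2 sigma : R, 0 < sigma &
      forall A : set R, measurable A ->
        P (Y @^-1` A) = normal_prob 0 sigma A)
   \/ P [set w | Y w != 0] = 0%E).

Definition centered_gaussian_process {d} {T : measurableType d} {R : realType}
  (P : probability T R) (X : R -> T -> R) : Prop :=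
  forall (n : nat) (s : 'I_n -> R) (a : 'I_n -> R),
    (forall i, 0 <= s i) ->
    centered_gaussian_rv P (fun w => \sum_(i < n) a i * X (s i) w).

Definition limsup_pinfty {R : realType} (f : R -> R) : \bar R :=
  limf_esup (fun s => (f s)%:E) (pinfty_nbhs R).

Definition lil_norm {R : realType} (rho s : R) : R :=
  Num.sqrt (2 * s `^ (2 * rho) * ln (ln s)).

(* Main.v *)
Require Import Defs.
From HB Require Import structures.
From mathcomp Require Import all_boot all_order all_algebra.
From mathcomp Require Import all_classical all_reals all_analysis.
From mathcomp Require Import measurable_realfun.
From mathcomp Require Import ring lra.
Import Order.TTheory GRing.Theory Num.Theory.
Import numFieldNormedType.Exports.
Local Open Scope classical_set_scope.
Local Open Scope ring_scope.

(* Upper bound: cut the half-line into blocks [a^n, a^(n+1)] with a close to 1.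
   By self-similarity the normalized oscillation of X on each block has the same
   law, and if a is close enough to 1 it is small with probability at least 3/4,
   by continuity of the paths. Fernique's inequality (rotation of two independent
   copies by pi/4) turns this into a Gaussian tail with small variance, so that
   Borel-Cantelli controls the left endpoints and the oscillations at the scale
   sqrt (2 log n).

   Lower bound: along the times e^(kM), k <= N = M^p, the normalized variables
   have unit variance and pairwise correlations O(M^(-eta)) = o(1 / log N). A
   truncated second moment argument, in which every quantity is a Gaussian
   exponential moment, shows that with probability tending to 1 one of them
   exceeds (1 - epsilon) sqrt (2 log N), and log log e^(kM) is at most
   (1 + 1/p) log N. *)

(** * Gaussian integrals *)

(** Only linear combinations of values of the process are known to be Gaussian, possibly degenerate,
    so no joint density is at hand. Joint laws are therefore compared through expectations of
    cosines of linear forms, each determined by one variance. Both the rotation in Fernique's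
    inequality and the self-similarity of the oscillations thus reduce to equalities of variances.
    Path continuity gives no rate for the oscillations, only smallness with probability close to 1.
    Fernique's iteration squares the ratio of the outer to the inner probability; the level 3/4
    makes the initial ratio at most 1/3. In the lower bound eta may be arbitrarily small, so a fixed
    spacing of the logarithmic times would not make the correlations negligible. The spacing M =
    N^(1/p) makes them polynomially small in N, at the price of the factor 1 + 1/p. Truncation is
    forced because untruncated exponential weights have a diagonal contribution expR (l^2) / N to
    the second moment, which is small only for l^2 < ln N, half of the required range. *)

Lemma integral_normal_prob {R : realType} (s : R) (h : R -> R) :
  measurable_fun setT h -> (forall x, 0 <= h x) ->
  (\int[normal_prob 0 s]_x (h x)%:E =
   \int[lebesgue_measure]_x (h x * normal_pdf 0 s x)%:E)%E.
Proof.
move=> mh h0.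
have dom := @normal_prob_dominates R 0 s.
have mh' : measurable_fun setT (fun x => (h x)%:E) by apply/measurable_EFinP.
rewrite -(Radon_Nikodym_SigmaFinite.change_of_variables dom)//.
have intf := Radon_Nikodym_SigmaFinite.f_integrable dom.
apply: ae_eq_integral => //.
- by apply: emeasurable_funM => //; exact: measurable_int intf.
- by apply/measurable_EFinP/measurable_funM => //; exact: measurable_normal_pdf.
under [X in ae_eq _ _ _ X]eq_fun do rewrite EFinM.
apply: ae_eqe_mul2l; apply: integral_ae_eq => //.
- by apply/measurable_EFinP; exact: measurable_normal_pdf.
- move=> E _ mE; rewrite -Radon_Nikodym_SigmaFinite.f_integral//.
Qed.

(** The value at [t = 0] is integration against the Dirac mass at 0, so that degenerate Gaussian
    variables are covered by the same formulas. *)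
Definition gauss_int {R : realType} (t : R) (h : R -> R) : \bar R :=
  if t == 0 then (h 0)%:E
  else (\int[lebesgue_measure]_x (h x * normal_pdf 0 t x)%:E)%E.

Lemma gaussian_law d (T : measurableType d) (R : realType)
    (P : probability T R) (Y : T -> R) : centered_gaussian_rv P Y ->
  exists2 t : R, 0 <= t & forall h : R -> R, measurable_fun setT h -> (forall x, 0 <= h x) ->
    (\int[P]_w (h (Y w))%:E = gauss_int t h)%E.
Proof.
move=> [mY [[s s0 PY]|Y0]].
  exists s; first exact: ltW.
  move=> h mh h0; rewrite /gauss_int (gt_eqF s0) -integral_normal_prob//.
  have mY' : measurable_fun setT (Y : T -> measurableTypeR R) by [].
  pose PY' := pushforward P (Y : T -> measurableTypeR R)
    : {measure set (measurableTypeR R) -> \bar R}.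
  transitivity (\int[PY' mY']_x (h x)%:E)%E.
    rewrite ge0_integral_pushforward//; first exact/measurable_EFinP.
    by move=> x _; rewrite lee_fin.
  by apply: eq_measure_integral => A mA _; exact: PY.
exists 0 => // h mh h0; rewrite /gauss_int eqxx.
transitivity (\int[P]_w (h 0)%:E)%E; last first.
  by rewrite integral_cst//= probability_setT mule1.
apply: (@ae_eq_integral _ T R P setT) => //.
- apply/measurable_EFinP; exact: measurableT_comp.
- exists [set w | Y w != 0]; split => //.
    rewrite (_ : [set _ | _] = Y @^-1` (~` [set 0])); last first.
      by apply/seteqP; split => w /= /eqP.
    rewrite -[X in measurable X]setTI; apply: mY => //; exact: measurableC.
  move=> w /= /not_implyP[_ H]; apply/negP => /eqP Yw; apply: H; by rewrite Yw.
Qed.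

Lemma gauss_int_expR {R : realType} (t l : R) :
  gauss_int t (fun x => expR (l * x)) = (expR (l ^+ 2 * t ^+ 2 / 2))%:E.
Proof.
rewrite /gauss_int; case: ifPn => [/eqP->|t0].
  by rewrite mulr0 expr0n/= mulr0 mul0r.
(* Completing the square: the exponential weight shifts the mean of the density to [l * t ^+ 2] and
   leaves a constant factor. *)
transitivity (\int[lebesgue_measure]_x
   ((expR (l ^+ 2 * t ^+ 2 / 2))%:E * (normal_pdf (l * t ^+ 2) t x)%:E))%E.
  apply: eq_integral => x _; rewrite -EFinM; congr EFin.
  rewrite !normal_pdfE// /normal_fun mulrCA [RHS]mulrCA -!expRD; congr (_ * expR _).
  by field.
rewrite ge0_integralZl//.
- by rewrite integral_normal_pdf mule1.
- by apply/measurable_EFinP; exact: measurable_normal_pdf.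
- by move=> x _; rewrite lee_fin normal_pdf_ge0.
Qed.

(** The exponent is the one that turns the density of standard deviation [t] into [c] times the
    density of standard deviation [c * t]. *)
Lemma gauss_int_expR_sqr {R : realType} (t c : R) : 0 < t -> 0 < c ->
  gauss_int t (fun x => expR ((1 - c ^- 2) * (x ^+ 2 / (t ^+ 2 *+ 2)))) = c%:E.
Proof.
move=> t0 c0; rewrite /gauss_int (gt_eqF t0).
have tN0 : t != 0 by rewrite gt_eqF.
have cN0 : c != 0 by rewrite gt_eqF.
transitivity (\int[lebesgue_measure]_x (c%:E * (normal_pdf 0 (c * t) x)%:E))%E.
  apply: eq_integral => x _; rewrite -EFinM; congr EFin.
  rewrite !normal_pdfE ?mulf_neq0// /normal_fun mulrCA -expRD [RHS]mulrA.
  congr (_ * expR _); last by rewrite subr0; field; rewrite tN0 cN0.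
  rewrite /normal_peak (_ : (c * t) ^+ 2 * pi *+ 2 = c ^+ 2 * (t ^+ 2 * pi *+ 2)); last first.
    by rewrite exprMn -mulrA mulrnAr.
  rewrite sqrtrM ?sqr_ge0// sqrtr_sqr gtr0_norm//.
  by rewrite invfM mulrA divff// mul1r.
rewrite ge0_integralZl//.
- by rewrite integral_normal_pdf mule1.
- by apply/measurable_EFinP; exact: measurable_normal_pdf.
- by move=> x _; rewrite lee_fin normal_pdf_ge0.
- by rewrite lee_fin ltW.
Qed.

Lemma le_gauss_int {R : realType} (t : R) (f g : R -> R) :
  measurable_fun setT f -> measurable_fun setT g ->
  (forall x, 0 <= f x <= g x) -> (gauss_int t f <= gauss_int t g)%E.
Proof.
move=> mf mg fg; rewrite /gauss_int; case: ifPn => _.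
  by rewrite lee_fin; have /andP[] := fg 0.
apply: ge0_le_integral => //.
- by move=> x _; rewrite lee_fin mulr_ge0 ?normal_pdf_ge0//; case/andP: (fg x).
- by apply/measurable_EFinP/measurable_funM => //; exact: measurable_normal_pdf.
- by apply/measurable_EFinP/measurable_funM => //; exact: measurable_normal_pdf.
- by move=> x _; rewrite lee_fin ler_wpM2r ?normal_pdf_ge0//; case/andP: (fg x).
Qed.

Lemma gauss_intD {R : realType} (t : R) (f g : R -> R) :
  measurable_fun setT f -> measurable_fun setT g ->
  (forall x, 0 <= f x) -> (forall x, 0 <= g x) ->
  gauss_int t (fun x => f x + g x) = (gauss_int t f + gauss_int t g)%E.
Proof.
move=> mf mg f0 g0; rewrite /gauss_int; case: ifPn => _ //.
under eq_integral do rewrite mulrDl EFinD.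
rewrite ge0_integralD//.
- by move=> x _; rewrite lee_fin mulr_ge0// normal_pdf_ge0.
- by apply/measurable_EFinP/measurable_funM => //; exact: measurable_normal_pdf.
- by move=> x _; rewrite lee_fin mulr_ge0// normal_pdf_ge0.
- by apply/measurable_EFinP/measurable_funM => //; exact: measurable_normal_pdf.
Qed.

Lemma gauss_intZ {R : realType} (t c : R) (f : R -> R) :
  measurable_fun setT f -> (forall x, 0 <= f x) -> 0 <= c ->
  gauss_int t (fun x => c * f x) = (c%:E * gauss_int t f)%E.
Proof.
move=> mf f0 c0; rewrite /gauss_int; case: ifPn => _ //.
under eq_integral do rewrite -mulrA EFinM.
rewrite ge0_integralZl//.
- by apply/measurable_EFinP/measurable_funM => //; exact: measurable_normal_pdf.
- by move=> x _; rewrite lee_fin mulr_ge0// normal_pdf_ge0.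
Qed.

Lemma gauss_int1 {R : realType} (t : R) : gauss_int t (fun=> 1) = 1%E.
Proof.
rewrite -[RHS]/(1%:E) -[X in _ = X%:E](expR0 R).
rewrite (_ : 0 = 0 ^+ 2 * t ^+ 2 / 2); last by rewrite expr0n/= !mul0r.
rewrite -gauss_int_expR; congr gauss_int; apply/funext => x.
by rewrite mul0r expR0.
Qed.

Lemma gauss_int_ge0 {R : realType} (t : R) (f : R -> R) :
  (forall x, 0 <= f x) -> (0 <= gauss_int t f)%E.
Proof.
move=> f0; rewrite /gauss_int; case: ifPn => _; first by rewrite lee_fin.
by apply: integral_ge0 => x _; rewrite lee_fin mulr_ge0// normal_pdf_ge0.
Qed.

(* For y = x^2 / (2 t^2) the inequality 1 + k y <= expR (k y), whose right-hand
   side integrates explicitly, pins down the mean of y as k = 1 - c^-2 tends to 0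
   from both sides. *)
Lemma gauss_int_sqr {R : realType} (t : R) : 0 <= t ->
  gauss_int t (fun x => x ^+ 2) = (t ^+ 2)%:E.
Proof.
rewrite le_eqVlt => /predU1P[<-|t0]; first by rewrite /gauss_int eqxx.
pose y (x : R) := x ^+ 2 / (t ^+ 2 *+ 2).
have d0 : 0 < t ^+ 2 *+ 2 by rewrite pmulrn_lgt0// exprn_gt0.
have y0 x : 0 <= y x by rewrite divr_ge0 ?sqr_ge0// ltW.
have my : measurable_fun setT y.
  by apply: measurable_funM => //; exact: measurable_funX.
have mexp (c : R) : measurable_fun setT (fun x => expR (c * y x)).
  by apply: measurableT_comp => //; exact: measurable_funM.
have -> : (fun x => x ^+ 2) = (fun x : R => (t ^+ 2 *+ 2) * y x).
  by apply/funext => x; rewrite mulrCA divff ?mulr1// gt_eqF.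
rewrite gauss_intZ// ?(ltW d0)//.
have up (c : R) : 1 < c -> (1 + (1 - c ^- 2)%:E * gauss_int t y <= c%:E)%E.
  move=> c1; have c0 : 0 < c by exact: lt_trans c1.
  have k0 : 0 <= 1 - c ^- 2.
    by rewrite subr_ge0 invf_le1 ?exprn_gt0// exprn_ege1// ltW.
  rewrite -(gauss_int_expR_sqr t c t0 c0) -[X in (X + _)%E](gauss_int1 t).
  rewrite -gauss_intZ// -gauss_intD//; last by move=> x; rewrite mulr_ge0.
    apply: le_gauss_int => //; first by apply: measurable_funD => //; exact: measurable_funM.
    by move=> x; rewrite expR_ge1Dx addr_ge0// mulr_ge0.
  exact: measurable_funM.
have lo (c : R) : 0 < c -> c < 1 ->
    (1 <= c%:E + (c ^- 2 - 1)%:E * gauss_int t y)%E.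
  move=> c0 c1.
  have k0 : 0 <= c ^- 2 - 1.
    by rewrite subr_ge0 invf_ge1 ?exprn_gt0// exprn_ile1// ltW.
  rewrite -[in leRHS](gauss_int_expR_sqr t c t0 c0) -[X in (X <= _)%E](gauss_int1 t).
  rewrite -gauss_intZ// -gauss_intD//; last by move=> x; rewrite mulr_ge0.
    apply: le_gauss_int => //.
      by apply: measurable_funD; [exact: mexp|exact: measurable_funM].
    move=> x; rewrite ler01/= -lerBlDr.
    by apply: le_trans (expR_ge1Dx _); rewrite -mulNr opprB.
  exact: measurable_funM.
have /= := gauss_int_ge0 t y y0; have := up 2 (ltr1n _ 2).
case: (gauss_int t y) up lo => [e||//] up lo /=; last first.
  by rewrite gt0_muley ?lte_fin//; lra.
move=> _ e0; rewrite -EFinM; congr EFin.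
(* Multiplying by c^2 and dividing by c - 1 gives e <= c^2 / (c + 1) = (c - 1) + 1 / (c + 1). For c
   < 1 the same computation gives the reverse inequality, and both bounds tend to 1/2 as c tends to
   1. *)
have {}up (c : R) : 1 < c -> e <= 2^-1 + (c - 1).
  move=> c1; have := up c c1; rewrite -EFinM -EFinD lee_fin => ec.
  have c0 : 0 < c by lra.
  have : (c ^+ 2 - 1) * e <= c ^+ 2 * (c - 1).
    rewrite (_ : (c ^+ 2 - 1) * e = c ^+ 2 * ((1 - c ^- 2) * e)); last first.
      by field; rewrite gt_eqF.
    by rewrite ler_pM2l ?exprn_gt0//; lra.
  rewrite (_ : c ^+ 2 - 1 = (c - 1) * (c + 1)); last by ring.
  rewrite [leRHS]mulrC -mulrA ler_pM2l; last lra.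
  nra.
have {}lo (c : R) : 0 < c -> c < 1 -> 2^-1 - (1 - c) <= e.
  move=> c0 c1; have := lo c c0 c1; rewrite -EFinM -EFinD lee_fin => ec.
  have : c ^+ 2 * (1 - c) <= (1 - c ^+ 2) * e.
    rewrite (_ : (1 - c ^+ 2) * e = c ^+ 2 * ((c ^- 2 - 1) * e)); last first.
      by field; rewrite gt_eqF.
    by rewrite ler_pM2l ?exprn_gt0//; lra.
  rewrite (_ : 1 - c ^+ 2 = (1 - c) * (c + 1)); last by ring.
  rewrite [leLHS]mulrC -mulrA ler_pM2l; last lra.
  nra.
have -> : e = 2^-1.
  apply/eqP; rewrite eq_le; apply/andP; split; apply/ler_addgt0Pr => d d0'.
    by have := up (1 + d); rewrite ltrDl => /(_ d0'); lra.
  have [d1|d1] := leP (2^-1 : R) d.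
    by have := lo 2^-1; rewrite invr_gt0 ltr0n => /(_ isT); lra.
  by have := lo (1 - d); lra.
by rewrite mulr2n; field.
Qed.

Lemma normal_peakE {R : realType} (s : R) : 0 < s ->
  normal_peak s = s^-1 * normal_peak 1.
Proof.
move=> s0; rewrite /normal_peak (_ : s ^+ 2 * pi *+ 2 = s ^+ 2 * (1 ^+ 2 * pi *+ 2)).
  by rewrite sqrtrM ?sqr_ge0// sqrtr_sqr gtr0_norm// invfM.
by rewrite expr1n mul1r mulrnAr.
Qed.

(** Both sides are the joint density at (x, z) of an N(0, a^2) variable and its sum with an
    independent N(0, b^2) variable. On the right it is disintegrated along the sum: the last factor
    is the conditional density of the first variable given that the sum equals z. *)
Lemma normal_pdf_conv {R : realType} (a b x z : R) : 0 < a -> 0 < b ->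
  let c := Num.sqrt (a ^+ 2 + b ^+ 2) in
  normal_pdf 0 b (z - x) * normal_pdf 0 a x =
  normal_pdf 0 c z * normal_pdf (z * (a ^+ 2 / c ^+ 2)) (a * b / c) x.
Proof.
move=> a0 b0 c.
have ab0 : 0 < a ^+ 2 + b ^+ 2 by rewrite addr_gt0// exprn_gt0.
have c0 : 0 < c by rewrite sqrtr_gt0.
have c2 : c ^+ 2 = a ^+ 2 + b ^+ 2 by rewrite sqr_sqrtr// ltW.
have d0 : 0 < a * b / c by rewrite divr_gt0// mulr_gt0.
rewrite !normal_pdfE ?gt_eqF// (normal_peakE a)// (normal_peakE b)//.
rewrite (normal_peakE c)// (normal_peakE (a * b / c))//.
rewrite /normal_fun mulrACA -expRD [RHS]mulrACA -expRD.
congr (_ * expR _).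
  by field; rewrite !gt_eqF.
rewrite expr_div_n exprMn c2; field.
by rewrite !gt_eqF.
Qed.

Lemma integral_translation {R : realType} (x : R) (g : R -> R) :
  continuous g -> (forall y, 0 <= g y) ->
  (\int[lebesgue_measure]_y (g y)%:E = \int[lebesgue_measure]_y (g (x + y))%:E)%E.
Proof.
move=> cg g0; pose F (y : R) := x + y.
have F'E : F^`()%classic = cst 1.
  by apply/funext => y; rewrite derive1E deriveD// derive_cst derive_id add0r.
rewrite (@increasing_ge0_integration_by_substitutionT _ F)//.
- by apply: eq_integral => y _; rewrite F'E /= mulr1.
- by move=> y z yz; rewrite ltrD2l.
- by rewrite F'E => ?; exact: cvg_cst.
- by rewrite F'E; exact: is_cvg_cst.
- by rewrite F'E; exact: is_cvg_cst.
- exact: cvg_addrl_Ny.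
- exact: cvg_addrl.
Qed.

Lemma measurable_gauss_int {R : realType} (t M : R) (h : R -> R) :
  measurable_fun setT h -> (forall x, 0 <= h x <= M) ->
  measurable_fun setT (fun x : R => fine (gauss_int t (fun y => h (x + y)))).
Proof.
move=> mh h0; rewrite /gauss_int; have [t0|t0] := eqVneq t 0.
  by under eq_fun do rewrite /= addr0.
have mf : measurable_fun setT
    (fun z : R * R => (h (z.1 + z.2) * normal_pdf 0 t z.2)%:E).
  apply/measurable_EFinP/measurable_funM.
    by apply: measurableT_comp => //; exact: measurable_funD.
  by apply: measurableT_comp => //; exact: measurable_normal_pdf.
apply: measurableT_comp => //.
apply: (@measurable_fun_fubini_tonelli_F _ _ (measurableTypeR R) (measurableTypeR R) R
  lebesgue_measure _ mf).
by move=> z; rewrite lee_fin mulr_ge0 ?normal_pdf_ge0//; case/andP: (h0 (z.1 + z.2)).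
Qed.

Lemma gauss_int_fin {R : realType} (t M : R) (h : R -> R) :
  measurable_fun setT h -> (forall x, 0 <= h x <= M) ->
  gauss_int t h \is a fin_num.
Proof.
move=> mh h0; rewrite ge0_fin_numE; last first.
  by apply: gauss_int_ge0 => x; case/andP: (h0 x).
apply: (@le_lt_trans _ _ (gauss_int t (fun=> M * 1))); last first.
  rewrite gauss_intZ ?gauss_int1//; first by rewrite mule1 ltry.
  by case/andP: (h0 0); exact: le_trans.
by apply: le_gauss_int => // x; rewrite mulr1.
Qed.

Lemma integral_lebesgueZl {R : realType} (c : R) (g : R -> R) :
  measurable_fun setT g -> (forall x, 0 <= g x) -> 0 <= c ->
  (\int[lebesgue_measure]_x (c * g x)%:E =
   c%:E * \int[lebesgue_measure]_x (g x)%:E)%E.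
Proof.
move=> mg g0 c0; under eq_integral do rewrite EFinM.
rewrite ge0_integralZl//; first exact/measurable_EFinP.
by move=> x _; rewrite lee_fin.
Qed.

Lemma integral_normal_pdf_conv {R : realType} (a b z : R) : 0 < a -> 0 < b ->
  (\int[lebesgue_measure]_x (normal_pdf 0 b (z - x) * normal_pdf 0 a x)%:E =
   (normal_pdf 0 (Num.sqrt (a ^+ 2 + b ^+ 2)) z)%:E)%E.
Proof.
move=> a0 b0; under eq_integral do rewrite normal_pdf_conv//.
rewrite integral_lebesgueZl ?normal_pdf_ge0//.
- by rewrite integral_normal_pdf mule1.
- exact: measurable_normal_pdf.
- by move=> x; exact: normal_pdf_ge0.
Qed.

(* Completing the square shows that N(0,a^2) * N(0,b^2) = N(0,a^2+b^2). *)
Lemma gauss_int_conv {R : realType} (a b M : R) (h : R -> R) :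
  0 <= a -> 0 <= b -> continuous h -> (forall x, 0 <= h x <= M) ->
  gauss_int a (fun x => fine (gauss_int b (fun y => h (x + y)))) =
  gauss_int (Num.sqrt (a ^+ 2 + b ^+ 2)) h.
Proof.
move=> a_ge0 b_ge0 ch h0M.
have h0 x : 0 <= h x by case/andP: (h0M x).
have mh : measurable_fun setT h by exact: continuous_measurable_fun.
have fb x : gauss_int b (fun y => h (x + y)) \is a fin_num.
  apply: (@gauss_int_fin _ _ M) => [|y]; last exact: h0M.
  by apply: measurableT_comp => //; exact: measurable_funD.
move: a_ge0; rewrite le_eqVlt => /predU1P[<-|a0].
  have -> : Num.sqrt (0 ^+ 2 + b ^+ 2) = b.
    by rewrite expr0n/= add0r sqrtr_sqr ger0_norm.
  rewrite {1}/gauss_int eqxx fineK//.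
  by congr gauss_int; apply/funext => y; rewrite add0r.
move: b_ge0 fb; rewrite le_eqVlt => /predU1P[<- _|b0 fb].
  have -> : Num.sqrt (a ^+ 2 + 0 ^+ 2) = a.
    by rewrite expr0n/= addr0 sqrtr_sqr gtr0_norm.
  by congr gauss_int; apply/funext => x; rewrite /gauss_int eqxx addr0.
set c := Num.sqrt _.
have c0 : 0 < c by rewrite sqrtr_gt0 addr_gt0// exprn_gt0.
(* The joint density of (x, x + y) weighted by [h] at the sum; integrating it in the two orders
   gives the two sides. *)
pose f (z : R * R) := (normal_pdf 0 a z.1 * (h z.2 * normal_pdf 0 b (z.2 - z.1)))%:E.
have mf : measurable_fun setT f.
  apply/measurable_EFinP/measurable_funM.
    by apply: measurableT_comp => //; exact: measurable_normal_pdf.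
  apply: measurable_funM; first exact: measurableT_comp.
  apply: measurableT_comp; first exact: measurable_normal_pdf.
  exact: measurable_funB.
have f0 z : (0 <= f z)%E by rewrite lee_fin !mulr_ge0 ?normal_pdf_ge0.
have int_y (x : R) : (\int[lebesgue_measure]_y f (x, y) =
    (fine (gauss_int b (fun y => h (x + y)%R)) * normal_pdf 0 a x)%:E)%E.
  rewrite /f/= integral_lebesgueZl ?normal_pdf_ge0//; last first.
    by move=> y; rewrite mulr_ge0 ?normal_pdf_ge0.
    apply: measurable_funM => //.
    by apply: measurableT_comp; [exact: measurable_normal_pdf|exact: measurable_funB].
  have -> : (fine (gauss_int b (fun y => h (x + y))) * normal_pdf 0 a x)%:E =
      ((normal_pdf 0 a x)%:E * gauss_int b (fun y => h (x + y)%R))%E.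
    by rewrite mulrC EFinM fineK.
  congr (_ * _)%E; rewrite /gauss_int (gt_eqF b0).
  rewrite (@integral_translation _ x (fun y => h y * normal_pdf 0 b (y - x))).
  - apply: eq_integral => y _; congr (_ * normal_pdf 0 b _)%:E.
    by rewrite addrC addKr.
  - move=> y; apply: cvgM; first exact: ch.
    apply: (@continuous_comp _ _ _ (fun y : R => y - x) (normal_pdf 0 b)).
      by apply: cvgB; [exact: cvg_id|exact: cvg_cst].
    by apply: continuous_normal_pdf; rewrite gt_eqF.
  - by move=> y; rewrite mulr_ge0 ?normal_pdf_ge0.
have int_x (z : R) : (\int[lebesgue_measure]_x f (x, z) =
    (h z * normal_pdf 0 c z)%:E)%E.
  transitivity (\int[lebesgue_measure]_x
      (h z * (normal_pdf 0 b (z - x) * normal_pdf 0 a x))%:E)%E.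
    by apply: eq_integral => x _; rewrite /f/= mulrC mulrA.
  rewrite integral_lebesgueZl//.
  - by rewrite integral_normal_pdf_conv.
  - apply: measurable_funM; last exact: measurable_normal_pdf.
    by apply: measurableT_comp; [exact: measurable_normal_pdf|exact: measurable_funB].
  - by move=> x; rewrite mulr_ge0 ?normal_pdf_ge0.
rewrite {1}/gauss_int (gt_eqF a0).
transitivity (\int[lebesgue_measure]_x \int[lebesgue_measure]_y f (x, y))%E.
  by apply: eq_integral => x _; rewrite int_y.
rewrite (@fubini_tonelli _ _ (measurableTypeR R) (measurableTypeR R) R
  lebesgue_measure lebesgue_measure f mf f0) /gauss_int (gt_eqF c0).
by apply: eq_integral => z _; exact: int_x.
Qed.

(** * Laws of boxes *)

Lemma bernoulli_le {R : realType} (x : R) (n : nat) : 0 <= 1 + x ->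
  1 + n%:R * x <= (1 + x) ^+ n.
Proof.
move=> x1; elim: n => [|n IH]; first by rewrite mul0r addr0 expr0.
rewrite exprS; apply: le_trans (ler_wpM2l x1 IH).
have := sqr_ge0 x; have n0 : 0 <= n%:R :> R by [].
by rewrite -natr1 => ?; nra.
Qed.

Lemma bounded_integrable d (T : measurableType d) (R : realType)
    (P : probability T R) (f : T -> R) (M : R) :
  measurable_fun setT f -> (forall x, `|f x| <= M) ->
  P.-integrable setT (fun x => (f x)%:E).
Proof.
move=> mf fM; apply: measurable_bounded_integrable => //.
  by rewrite /= probability_setT ltry.
exists M; split; first by rewrite num_real.
by move=> M' MM' x _; apply: le_trans (fM x) (ltW MM').
Qed.

Lemma cvg_integral_bounded d (T : measurableType d) (R : realType)
    (P : probability T R) (f_ : nat -> T -> R) (f : T -> R) :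
  (forall n, measurable_fun setT (f_ n)) -> (forall n x, `|f_ n x| <= 1) ->
  (forall x, f_ n x @[n --> \oo] --> f x) ->
  (\int[P]_x (f_ n x)%:E @[n --> \oo] --> \int[P]_x (f x)%:E)%E.
Proof.
move=> mf f1 ff.
apply: (@dominated_cvg _ _ _ _ _ _ (fun n x => (f_ n x)%:E) _ (cst 1%E)) => //.
- by move=> n; exact/measurable_EFinP.
- move=> x _; apply: cvg_EFin; first exact: nearW.
  exact: ff.
- exact: finite_measure_integrable_cst.
- by move=> n x _; rewrite /= lee_fin.
Qed.

(** Cosines of linear forms suffice as generators: products of cosines are again combinations of
    cosines, and the expectation of each generator depends only on the law of a single linear
    combination. *)
Inductive trigpoly {R : realType} {I : finType} : ((I -> R) -> R) -> Prop :=
| trigpoly_cos a : trigpoly (fun x => cos (\sum_i a i * x i))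
| trigpolyD f g : trigpoly f -> trigpoly g -> trigpoly (fun x => f x + g x)
| trigpolyZ c f : trigpoly f -> trigpoly (fun x => c * f x).

Section trigpoly.
Context {R : realType} {I : finType}.
Implicit Types (f g : (I -> R) -> R).

Lemma cos_mul (x y : R) : cos x * cos y = 2^-1 * (cos (x + y) + cos (x - y)).
Proof. by rewrite cosD cosB; field. Qed.

Lemma trigpolyM f g : trigpoly f -> trigpoly g -> trigpoly (fun x => f x * g x).
Proof.
elim=> [a|f1 f2 _ IH1 _ IH2|c f1 _ IH] tg.
- elim: tg => [b|g1 g2 _ IH1 _ IH2|c g1 _ IH].
  + have -> : (fun x : I -> R => cos (\sum_i a i * x i) * cos (\sum_i b i * x i)) =
        (fun x => 2^-1 * (cos (\sum_i (a i + b i) * x i) +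
                          cos (\sum_i (a i - b i) * x i))).
      apply/funext => x; rewrite cos_mul; congr (_ * (cos _ + cos _)).
        by rewrite -big_split; apply: eq_bigr => i _; rewrite mulrDl.
      by rewrite -sumrB; apply: eq_bigr => i _; rewrite mulrBl.
    by apply/trigpolyZ/trigpolyD; exact: trigpoly_cos.
  + by under eq_fun do rewrite mulrDr; exact: trigpolyD.
  + by under eq_fun do rewrite mulrCA; exact: trigpolyZ.
- by under eq_fun do rewrite mulrDl; apply: trigpolyD; [exact: IH1|exact: IH2].
- by under eq_fun do rewrite -mulrA; apply: trigpolyZ; exact: IH.
Qed.

Lemma trigpoly_cst (c : R) : trigpoly (fun _ : I -> R => c).
Proof.
have -> : (fun=> c) = (fun x : I -> R => c * cos (\sum_i 0 * x i)).
  by apply/funext => x; rewrite big1 ?cos0 ?mulr1// => i _; rewrite mul0r.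
exact/trigpolyZ/trigpoly_cos.
Qed.

Lemma trigpolyX f n : trigpoly f -> trigpoly (fun x => f x ^+ n).
Proof.
move=> tf; elim: n => [|n IH]; first exact: trigpoly_cst.
by under eq_fun do rewrite exprS; exact: trigpolyM.
Qed.

Lemma trigpolyB1 f : trigpoly f -> trigpoly (fun x => 1 - f x).
Proof.
move=> tf; under eq_fun do rewrite -mulN1r; apply: trigpolyD.
  exact: trigpoly_cst.
exact: trigpolyZ.
Qed.

Lemma trigpoly_prod (D : pred I) (f : I -> (I -> R) -> R) :
  (forall i, trigpoly (f i)) -> trigpoly (fun x => \prod_(i | D i) f i x).
Proof.
move=> tf; elim: (index_enum I) => [|i s IH].
  by under eq_fun do rewrite big_nil; exact: trigpoly_cst.
under eq_fun do rewrite big_cons; case: (D i) => //.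
exact: trigpolyM.
Qed.

Lemma trigpoly_cos1 (i : I) (c : R) : trigpoly (fun x => cos (c * x i)).
Proof.
have -> : (fun x : I -> R => cos (c * x i)) =
    (fun x : I -> R => cos (\sum_k (if k == i then c else 0) * x k)).
  apply/funext => x; rewrite (bigD1 i)//= eqxx big1 ?addr0// => k /negbTE ->.
  by rewrite mul0r.
exact: trigpoly_cos.
Qed.

Lemma trigpoly_bounded f : trigpoly f -> exists M, forall x, `|f x| <= M.
Proof.
elim=> [a|f1 f2 _ [M1 h1] _ [M2 h2]|c f1 _ [M h]].
- by exists 1 => x; exact: cos_max.
- by exists (M1 + M2) => x; apply: le_trans (ler_normD _ _) (lerD _ _).
- by exists (`|c| * M) => x; rewrite normrM ler_wpM2l.
Qed.

Lemma measurable_trigpoly d (T : measurableType d) (U : I -> T -> R) f :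
  (forall i, measurable_fun setT (U i)) -> trigpoly f ->
  measurable_fun setT (fun w => f (U ^~ w)).
Proof.
move=> mU; elim=> [a|f1 f2 _ h1 _ h2|c f1 _ h].
- apply: (@measurableT_comp _ _ _ _ _ _ cos).
    by apply: continuous_measurable_fun; exact: continuous_cos.
  by apply: measurable_sum => i; exact: measurable_funM.
- exact: measurable_funD.
- exact: measurable_funM.
Qed.

Lemma trigpoly_integrable d (T : measurableType d) (P : probability T R)
    (U : I -> T -> R) f :
  (forall i, measurable_fun setT (U i)) -> trigpoly f ->
  P.-integrable setT (fun w => (f (U ^~ w))%:E).
Proof.
move=> mU tf; have [M fM] := trigpoly_bounded _ tf.
by apply: (@bounded_integrable _ _ _ _ _ M) => //; exact: measurable_trigpoly.
Qed.

Lemma trigpoly_integral d (T : measurableType d) (P : probability T R)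
    d' (T' : measurableType d') (P' : probability T' R)
    (U : I -> T -> R) (V : I -> T' -> R) f :
  (forall i, measurable_fun setT (U i)) -> (forall i, measurable_fun setT (V i)) ->
  (forall a : I -> R,
    \int[P]_w (1 + cos (\sum_i a i * U i w))%:E =
    \int[P']_w (1 + cos (\sum_i a i * V i w))%:E)%E ->
  trigpoly f ->
  (\int[P]_w (f (U ^~ w))%:E = \int[P']_w (f (V ^~ w))%:E)%E.
Proof.
move=> mU mV UV; elim=> [a|f1 f2 t1 h1 t2 h2|c f1 t1 h].
- have ia e (S : measurableType e) (Q : probability S R) (W : I -> S -> R) :
      (forall i, measurable_fun setT (W i)) ->
      (\int[Q]_w (1 + cos (\sum_i a i * W i w))%:E =
       1 + \int[Q]_w (cos (\sum_i a i * W i w))%:E)%E.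
    move=> mW; under eq_integral do rewrite EFinD.
    rewrite integralD//.
    + by rewrite integral_cst//= probability_setT mule1.
    + exact: finite_measure_integrable_cst.
    + exact: (trigpoly_integrable _ _ _ _ _ mW (trigpoly_cos a)).
  have := UV a; rewrite !ia// ![(1 + _)%E]addeC.
  by move=> /(congr1 (fun z => z - 1)%E); rewrite !addeK.
- under eq_integral do rewrite EFinD.
  under [RHS]eq_integral do rewrite EFinD.
  by rewrite !integralD ?h1 ?h2//; exact: trigpoly_integrable.
- under eq_integral do rewrite EFinM.
  under [RHS]eq_integral do rewrite EFinM.
  by rewrite !integralZl ?h//; exact: trigpoly_integrable.
Qed.

End trigpoly.

(** * Approximation of a step function by polynomials *)

Lemma cvg_natmul_geometric {R : realType} (z : R) : 0 <= z -> z < 1 ->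
  n%:R * z ^+ n @[n --> \oo] --> (0 : R).
Proof.
move=> z0 z1; pose w := Num.sqrt z.
have w0 : 0 <= w by exact: sqrtr_ge0.
have w1 : w < 1 by rewrite -[ltRHS]sqrtr1 ltr_sqrt.
(* Splitting z^n into two factors w^n, one absorbs [n] by this bound and the other still tends to
   0. *)
have wn n : n%:R * w ^+ n * (1 - w) <= 1 - w ^+ n.
  elim: n => [|n IH]; first by rewrite !mul0r expr0 subrr.
  have wn0 : 0 <= w ^+ n by rewrite exprn_ge0.
  have wn1 : w ^+ n <= 1 by rewrite exprn_ile1// ltW.
  have wu : w * w ^+ n <= 1 by rewrite mulr_ile1// ltW.
  have h1 : 0 <= (1 - w) * (1 - w * w ^+ n) by rewrite mulr_ge0 ?subr_ge0// ltW.
  have h2 := ler_wpM2l w0 IH.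
  by rewrite -natr1 exprS; move: h1 h2; move: (w ^+ n) => u; lra.
apply: (@squeeze_cvgr _ _ _ _ (cst 0) (geometric (1 - w)^-1 w)); last 2 first.
- exact: cvg_cst.
- by apply: cvg_geometric; rewrite ger0_norm.
apply: nearW => n; rewrite mulr_ge0 ?exprn_ge0//=.
have -> : z ^+ n = w ^+ n * w ^+ n by rewrite -exprMn -expr2 sqr_sqrtr.
rewrite mulrA ler_wpM2r ?exprn_ge0// -[leRHS]mul1r ler_pdivlMr ?subr_gt0//.
by apply: le_trans (wn n) _; rewrite gerBl exprn_ge0.
Qed.

(* The exponent is chosen so that [step_exp y0 n * y ^+ n] tends to infinity for
   y >= y0 and to 0 for y < y0. *)
Definition step_exp {R : realType} (y0 : R) (n : nat) :=
  (n * (Num.truncn (y0 ^- n)).+1)%N.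

(** Write u = y^n and k for the exponent. If y >= y0, then k u >= n, and (1 - u)^k (1 + u)^k <= 1
    together with Bernoulli's inequality gives (1 - u)^k <= 1 / (1 + n). If y < y0, Bernoulli's
    inequality bounds 1 - (1 - u)^k by k u, at most twice n (y / y0)^n. *)
Lemma cvg_step {R : realType} (y0 y : R) : 0 < y0 -> y0 <= 1 -> 0 <= y -> y <= 1 ->
  1 - (1 - y ^+ n) ^+ step_exp y0 n @[n --> \oo] --> ((y0 <= y)%R%:R : R).
Proof.
move=> y00 y01 y1 y2.
have u0 n : 0 <= y ^+ n by rewrite exprn_ge0.
have u1 n : y ^+ n <= 1 by rewrite exprn_ile1.
have [yy|yy] := leP y0 y.
  rewrite -[X in _ --> X](subr0 1); apply: cvgB; first exact: cvg_cst.
  apply: (@squeeze_cvgr _ _ _ _ (cst 0) (fun n => harmonic n)); last 2 first.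
  - exact: cvg_cst.
  - exact: cvg_harmonic.
  apply: nearW => n; rewrite /= exprn_ge0 ?subr_ge0//=.
  set k := step_exp y0 n.
  have kn : 1 + n%:R <= 1 + k%:R * y ^+ n.
    rewrite lerD2l /k /step_exp natrM -mulrA ler_peMr//.
    apply: (@le_trans _ _ (y0 ^- n * y ^+ n)).
      by rewrite mulrC ler_pdivlMr ?exprn_gt0// mul1r lerXn2r// nnegrE// ltW.
    by rewrite ler_wpM2r// ltW// truncnS_gt.
  rewrite /harmonic/= -natr1 [n%:R + 1]addrC -[leRHS]mul1r ler_pdivlMr; last first.
    by rewrite ltr_pwDl.
  apply: (@le_trans _ _ ((1 - y ^+ n) ^+ k * (1 + y ^+ n) ^+ k)).
    apply: ler_wpM2l; first by rewrite exprn_ge0// subr_ge0.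
    apply: le_trans kn _; by apply: bernoulli_le; rewrite addr_ge0.
  rewrite -exprMn exprn_ile1//.
    by rewrite mulr_ge0 ?subr_ge0// addr_ge0.
  by rewrite -subr_sqr expr1n gerBl sqr_ge0.
pose z := y / y0.
have z0 : 0 <= z by rewrite divr_ge0// ltW.
have z1 : z < 1 by rewrite ltr_pdivrMr// mul1r.
apply: (@squeeze_cvgr _ _ _ _ (cst 0) (fun n => 2 * (n%:R * z ^+ n))); last 2 first.
- exact: cvg_cst.
- rewrite -[X in _ --> X](mulr0 2); apply: cvgM; first exact: cvg_cst.
  exact: cvg_natmul_geometric.
apply: nearW => n /=; rewrite subr_ge0 exprn_ile1 ?subr_ge0 ?gerBl//=.
set k := step_exp y0 n.
have : 1 + k%:R * - y ^+ n <= (1 - y ^+ n) ^+ k.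
  by apply: bernoulli_le; rewrite subr_ge0.
have zn : z ^+ n = y0 ^- n * y ^+ n by rewrite expr_div_n mulrC.
have yz : y ^+ n <= z ^+ n.
  by rewrite lerXn2r ?nnegrE// ler_pdivlMr// ler_piMr.
have : k%:R * y ^+ n <= 2 * (n%:R * z ^+ n).
  rewrite /k /step_exp natrM -mulrA [leRHS]mulrCA ler_wpM2l//.
  rewrite -natr1 mulrDl mul1r (_ : 2 * z ^+ n = z ^+ n + z ^+ n); last by ring.
  rewrite lerD// zn ler_wpM2r//.
  by rewrite truncn_le invr_ge0 exprn_ge0// ltW.
by lra.
Qed.

Lemma cvg_prod {R : realType} {I : finType} (D : pred I) (f : I -> nat -> R) (l : I -> R) :
  (forall i, f i n @[n --> \oo] --> l i) ->
  \prod_(i | D i) f i n @[n --> \oo] --> \prod_(i | D i) l i.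
Proof.
move=> fl; elim: (index_enum I) => [|i s IH].
  under eq_cvg do rewrite big_nil.
  by rewrite big_nil; exact: cvg_cst.
under eq_cvg do rewrite big_cons.
by rewrite big_cons; case: (D i) => //; apply: cvgM.
Qed.

Lemma prod_natr_bool {R : realType} {I : finType} (D B : pred I) :
  \prod_(i | D i) ((B i)%:R : R) = [forall (i | D i), B i]%:R.
Proof.
have [/forall_inP h|] := boolP [forall (i | D i), B i].
  by rewrite big1// => i /h ->.
rewrite negb_forall_in => /exists_inP[i Di /negbTE Bi].
by rewrite (bigD1 i)//= Bi mul0r.
Qed.

Lemma measure_integral_indic d (T : measurableType d) (R : realType)
    (mu : {measure set T -> \bar R}) (A : set T) : measurable A ->
  mu A = (\int[mu]_w (\1_A w)%:E)%E.
Proof. by move=> mA; rewrite integral_indic// setIT. Qed.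

Lemma measurable_set_le d (T : measurableType d) (R : realType) (f g : T -> R) :
  measurable_fun setT f -> measurable_fun setT g ->
  measurable [set w | f w <= g w].
Proof.
by move=> mf mg; rewrite -[X in measurable X]setTI; exact: measurable_fun_le.
Qed.

Lemma measurable_box d (T : measurableType d) (R : realType) (I : finType)
    (U : I -> T -> R) (D : pred I) (b : I -> R) :
  (forall i, measurable_fun setT (U i)) ->
  measurable [set w | forall i, D i -> `|U i w| <= b i].
Proof.
move=> mU.
rewrite (_ : [set _ | _] = \bigcap_(i in [set` D]) [set w | `|U i w| <= b i])//.
apply: fin_bigcap_measurable => // i _.
by apply: measurable_set_le => //; exact: measurableT_comp.
Qed.

(* The Cramer-Wold device for boxes: the indicator of a box is a limit of
   trigonometric polynomials. The summand 1 keeps the test functions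
   nonnegative. *)
Lemma box_law d (T : measurableType d) (R : realType) (P : probability T R)
    d' (T' : measurableType d') (P' : probability T' R) (I : finType)
    (U : I -> T -> R) (V : I -> T' -> R) (D : pred I) (b : I -> R) :
  (forall i, measurable_fun setT (U i)) -> (forall i, measurable_fun setT (V i)) ->
  (forall a : I -> R,
    \int[P]_w (1 + cos (\sum_i a i * U i w))%:E =
    \int[P']_w (1 + cos (\sum_i a i * V i w))%:E)%E ->
  (forall i, 0 <= b i) ->
  P [set w | forall i, D i -> `|U i w| <= b i] =
  P' [set w | forall i, D i -> `|V i w| <= b i].
Proof.
move=> mU mV UV b0.
pose B := \sum_i b i.
have bB i : b i <= B by rewrite /B (bigD1 i)//= lerDl sumr_ge0.
have B0 : 0 <= B by exact: sumr_ge0.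
(* The scale keeps every [b i * c j] below 1, inside the interval where cosine decreases. It tends
   to 0 with [j], so that any fixed point is eventually inside this interval too, which removes the
   false positives due to periodicity. *)
pose c (j : nat) : R := (j.+1%:R + B)^-1.
have c0 j : 0 < c j by rewrite invr_gt0 ltr_wpDr.
have bc j i : b i * c j < 1.
  rewrite ltr_pdivrMr ?mul1r; last by rewrite ltr_wpDr.
  by apply: le_lt_trans (bB i) _; rewrite ltrDr.
have pi1 : 1 < pi :> R by have := pi_ge2 R; lra.
(* Cosine rescaled to take values in [0, 1]; near the origin it decreases in the absolute value of
   [x], so the box condition becomes a lower threshold, as [cvg_step] requires. *)
pose y (j : nat) (x : R) := (1 + cos (c j * x)) / 2.
have y0 j x : 0 <= y j x by have := cos_geN1 (c j * x); rewrite /y; lra.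
have y1 j x : y j x <= 1 by have := cos_le1 (c j * x); rewrite /y; lra.
have yb0 j i : 0 < y j (b i).
  have : cos pi < cos (c j * b i).
    rewrite ltr_cos ?in_itv/= ?lexx ?pi_ge0//.
      by rewrite mulrC (lt_trans (bc j i)).
    by rewrite mulr_ge0 ?(ltW (c0 j))//= mulrC ltW// (lt_trans (bc j i)).
  by rewrite cospi /y; lra.
pose F j n (x : I -> R) := \prod_(i | D i)
  (1 - (1 - y j (x i) ^+ n) ^+ step_exp (y j (b i)) n).
pose G j (x : I -> R) : R := [forall (i | D i), y j (b i) <= y j (x i)]%R%:R.
pose H (x : I -> R) : R := [forall (i | D i), `|x i| <= b i]%R%:R.
have tF j n : trigpoly (F j n).
  apply: trigpoly_prod => i; do 2 (apply: trigpolyB1; apply: trigpolyX).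
  rewrite /y; under eq_fun do rewrite mulrC.
  by apply/trigpolyZ/trigpolyD; [exact: trigpoly_cst|exact: trigpoly_cos1].
have F01 j n x : `|F j n x| <= 1.
  rewrite normr_prod; set p := \prod_(i | D i) _.
  suff /andP[] : 0 <= p <= 1 by [].
  apply: (big_ind (fun z => 0 <= z <= 1)); first by rewrite ler01 lexx.
    move=> u v /andP[u0 u1] /andP[v0 v1].
    by rewrite mulr_ge0//= mulr_ile1.
  move=> i _; have y0n : 0 <= y j (x i) ^+ n by rewrite exprn_ge0.
  have y1n : y j (x i) ^+ n <= 1 by rewrite exprn_ile1.
  have : 0 <= (1 - y j (x i) ^+ n) ^+ step_exp (y j (b i)) n <= 1.
    by rewrite exprn_ge0 ?subr_ge0// exprn_ile1// ?subr_ge0// gerBl.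
  by move=> /andP[e0 e1]; rewrite normr_ge0 ger0_norm ?subr_ge0// gerBl.
have FG j x : F j n x @[n --> \oo] --> G j x.
  rewrite /G -prod_natr_bool; apply: cvg_prod => i.
  exact: cvg_step.
have cle (u v : R) : 0 <= u -> u < 1 -> 0 <= v -> v < 1 ->
    (cos u <= cos v) = (v <= u).
  move=> u0 u1 v0 v1; rewrite !leNgt ltr_cos// in_itv/=.
    by rewrite u0 ltW// (lt_trans u1).
  by rewrite v0 ltW// (lt_trans v1).
have GH x : G j x @[j --> \oo] --> H x.
  pose X := \sum_i `|x i|.
  have xX i : `|x i| <= X by rewrite /X (bigD1 i)//= lerDl sumr_ge0.
  apply: cvg_near_cst; near=> j; rewrite /G /H; congr (nat_of_bool _)%:R.
  have Xj : X < j%:R by near: j; exact: nbhs_infty_gtr.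
  apply: eq_forallb_in => i _.
  have xj : `|x i| * c j < 1.
    rewrite ltr_pdivrMr ?mul1r; last by rewrite ltr_wpDr.
    by have := xX i; rewrite -natr1; lra.
  rewrite /y ler_pM2r ?invr_gt0// lerD2l.
  have -> : cos (c j * x i) = cos (c j * `|x i|).
    by case: (ger0P (x i)) => // _; rewrite mulrN cosN.
  have cj := ltW (c0 j).
  by rewrite cle ?mulr_ge0// ?[c j * _]mulrC// ler_pM2r.
have main e (S : measurableType e) (Q : probability S R) (W : I -> S -> R) :
    (forall i, measurable_fun setT (W i)) ->
    [/\ forall j, (\int[Q]_w (F j n (W ^~ w))%:E @[n --> \oo] -->
                   \int[Q]_w (G j (W ^~ w))%:E)%E,
        (\int[Q]_w (G j (W ^~ w))%:E @[j --> \oo] -->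
         \int[Q]_w (H (W ^~ w))%:E)%E &
        (\int[Q]_w (H (W ^~ w))%:E =
         Q [set w | forall i, D i -> (`|W i w| <= b i)%R])%E].
  move=> mW.
  have mF j n : measurable_fun setT (fun w => F j n (W ^~ w)).
    exact: measurable_trigpoly.
  split.
  - by move=> j; apply: cvg_integral_bounded.
  - apply: cvg_integral_bounded => //.
    + by move=> j; apply: (measurable_fun_cvg (mF j)).
    + by move=> j w; rewrite /G normr_nat lern1 leq_b1.
  - rewrite measure_integral_indic; last exact: measurable_box.
    apply: eq_integral => w _; rewrite /H indicE; congr (nat_of_bool _)%:R%:E.
    by apply/forall_inP/idP; rewrite inE.
have [FU GU <-] := main _ _ P U mU; have [FV GV <-] := main _ _ P' V mV.
have FE j n : (\int[P]_w (F j n (U ^~ w))%:E = \int[P']_w (F j n (V ^~ w))%:E)%E.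
  exact: trigpoly_integral.
have GE j : (\int[P]_w (G j (U ^~ w))%:E = \int[P']_w (G j (V ^~ w))%:E)%E.
  have h := FU j; rewrite (eq_cvg _ _ (FE j)) in h.
  exact: (cvg_unique _ h (FV j)).
by rewrite (eq_cvg _ _ GE) in GU; exact: (cvg_unique _ GU GV).
Unshelve. all: by end_near.
Qed.

(** * Fernique's inequality *)

Lemma measurable_set_lt d (T : measurableType d) (R : realType) (f g : T -> R) :
  measurable_fun setT f -> measurable_fun setT g ->
  measurable [set w | f w < g w].
Proof.
move=> mf mg; rewrite (_ : [set _ | _] = ~` [set w | g w <= f w]).
  by apply: measurableC; exact: measurable_set_le.
by apply/seteqP; split=> w /=; rewrite ltNge => /negP.
Qed.

Lemma measure_bigcup_le d (T : measurableType d) (R : realType)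
    (mu : {measure set T -> \bar R}) (E : nat -> set T) (c : \bar R) :
  (forall n, measurable (E n)) ->
  {homo E : m n / (m <= n)%N >-> (m <= n)%O} -> (forall n, mu (E n) <= c)%E ->
  (mu (\bigcup_n E n) <= c)%E.
Proof.
move=> mE ndE Ec.
have h : mu (E n) @[n --> \oo] --> mu (\bigcup_n E n).
  exact: nondecreasing_cvg_mu mE (bigcup_measurable (fun k _ => mE k)) ndE.
rewrite -(cvg_lim (@ereal_hausdorff R) h); apply: lime_le; first by apply/cvg_ex; exists (mu (\bigcup_n E n)).
exact: nearW.
Qed.

Lemma gaussian_sqr_law d (T : measurableType d) (R : realType)
    (P : probability T R) (Y : T -> R) : centered_gaussian_rv P Y ->
  exists t : R, [/\ 0 <= t, (\int[P]_w (Y w ^+ 2)%:E)%E = (t ^+ 2)%:E &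
    forall h : R -> R, measurable_fun setT h -> (forall x, 0 <= h x) ->
      (\int[P]_w (h (Y w))%:E = gauss_int t h)%E].
Proof.
move=> /gaussian_law[t t0 law]; exists t; split=> //.
rewrite (law (fun x => x ^+ 2)) ?gauss_int_sqr//.
by move=> x; exact: sqr_ge0.
Qed.

Lemma gaussian_law_sqr d (T : measurableType d) (R : realType)
    (P : probability T R) (Y : T -> R) (v : R) : centered_gaussian_rv P Y ->
  (\int[P]_w (Y w ^+ 2)%:E)%E = v%:E ->
  forall h : R -> R, measurable_fun setT h -> (forall x, 0 <= h x) ->
    (\int[P]_w (h (Y w))%:E = gauss_int (Num.sqrt v) h)%E.
Proof.
move=> /gaussian_sqr_law[t [t0 -> law]] [<-].
by rewrite sqrtr_sqr ger0_norm.
Qed.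

Lemma gaussian_mgf d (T : measurableType d) (R : realType)
    (P : probability T R) (Y : T -> R) (v l : R) : centered_gaussian_rv P Y ->
  (\int[P]_w (Y w ^+ 2)%:E)%E = v%:E ->
  (\int[P]_w (expR (l * Y w))%:E = (expR (l ^+ 2 * v / 2))%:E)%E.
Proof.
move=> gY Yv; have v0 : 0 <= v.
  by rewrite -lee_fin -Yv integral_ge0// => w _; rewrite lee_fin sqr_ge0.
rewrite (gaussian_law_sqr _ _ _ _ _ v gY Yv (fun x => expR (l * x))).
- by rewrite gauss_int_expR sqr_sqrtr.
- by apply: measurableT_comp => //; exact: measurable_funM.
- by move=> x; exact: expR_ge0.
Qed.

Lemma gaussian_prod_law d (T : measurableType d) (R : realType)
    (P : probability T R) (Y Z : T -> R) (v M : R) (h : R -> R) :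
  centered_gaussian_rv P Y -> centered_gaussian_rv P Z ->
  (\int[P]_w (Y w ^+ 2)%:E + \int[P]_w (Z w ^+ 2)%:E = v%:E)%E ->
  continuous h -> (forall x, 0 <= h x <= M) ->
  (\int[P \x P]_w (h (Y w.1 + Z w.2))%:E = gauss_int (Num.sqrt v) h)%E.
Proof.
move=> gY gZ + ch h0M.
have h0 x : 0 <= h x by case/andP: (h0M x).
have [mY mZ] := (gY.1, gZ.1).
have [t [t0 -> lawY]] := gaussian_sqr_law _ _ _ _ _ gY.
have [u [u0 -> lawZ]] := gaussian_sqr_law _ _ _ _ _ gZ.
rewrite -EFinD => -[<-].
have mh : measurable_fun setT h by exact: continuous_measurable_fun.
have mhx (x : R) : measurable_fun setT (fun y : R => h (x + y)).
  by apply: measurableT_comp => //; exact: measurable_funD.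
have mf : measurable_fun setT (fun w : T * T => (h (Y w.1 + Z w.2))%:E).
  apply/measurable_EFinP; apply: measurableT_comp => //.
  by apply: measurable_funD; exact: measurableT_comp.
rewrite (fubini_tonelli1 _ mf); last by move=> w; rewrite lee_fin.
rewrite -(gauss_int_conv _ _ M)// -lawY.
- apply: eq_integral => w _; rewrite /fubini_F/= fineK.
    by rewrite (lawZ (fun y => h (Y w + y))).
  by apply: (gauss_int_fin _ M).
- exact: (measurable_gauss_int _ M).
- by move=> x; rewrite fine_ge0// gauss_int_ge0.
Qed.

(** A linear space of centered Gaussian variables: closure under combinations encodes joint
    Gaussianity, and stability under passing to the rotated coefficients is what Fernique's argument
    uses. *)
Definition gaussian_space d (T : measurableType d) (R : realType)
    (P : probability T R) (H : (T -> R) -> Prop) :=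
  [/\ H (fun=> 0), (forall Y Z, H Y -> H Z -> H (fun w => Y w + Z w)),
      (forall c Y, H Y -> H (fun w => c * Y w)) &
      (forall Y, H Y -> centered_gaussian_rv P Y)].

Lemma gaussian_space_sum d (T : measurableType d) (R : realType)
    (P : probability T R) (H : (T -> R) -> Prop) (I : finType)
    (Z : I -> T -> R) (a : I -> R) :
  gaussian_space _ _ _ P H -> (forall i, H (Z i)) ->
  H (fun w => \sum_i a i * Z i w).
Proof.
move=> [H0 HD HM _] HZ; elim: (index_enum I) => [|i s IH].
  by under eq_fun do rewrite big_nil.
under eq_fun do rewrite big_cons.
by apply: (HD (fun w => a i * Z i w)) => //; exact: HM.
Qed.

Section fernique.
Context d (T : measurableType d) (R : realType) (P : probability T R).
Context (H : (T -> R) -> Prop) (n : nat) (Z : 'I_n -> T -> R).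
Hypotheses (gH : gaussian_space _ _ _ P H) (HZ : forall i, H (Z i)).

Let mZ i : measurable_fun setT (Z i).
Proof. by case: gH => _ _ _ /(_ _ (HZ i))[]. Qed.

Let inbox (s : R) := [set w | forall i, true -> `|Z i w| <= s].
Let outbox (s : R) := [set w | exists i, s < `|Z i w|].

Let outboxE s : outbox s = ~` inbox s.
Proof.
apply/seteqP; split=> w /=.
  by move=> [i si] /(_ i isT); rewrite leNgt si.
by move=> /existsNP[i /not_implyP[_ /negP]]; rewrite -ltNge; exists i.
Qed.

Let minbox s : measurable (inbox s).
Proof. exact: measurable_box. Qed.

Let moutbox s : measurable (outbox s).
Proof. by rewrite outboxE; exact: measurableC. Qed.

(* Invariance of the law of two independent copies under the rotation by pi/4. *)
Lemma fernique_step (s t : R) : 0 <= s -> 0 <= t ->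
  (P (inbox s) * P (outbox t) <=
   P (outbox ((t - s) / Num.sqrt 2)) * P (outbox ((t - s) / Num.sqrt 2)))%E.
Proof.
move=> s0 t0.
pose q : R := Num.sqrt 2.
have q0 : 0 < q by rewrite sqrtr_gt0.
have q2 : q ^+ 2 = 2 by rewrite sqr_sqrtr.
pose U (k : bool * 'I_n) (w : T * T) := Z k.2 (if k.1 then w.1 else w.2).
pose V (k : bool * 'I_n) (w : T * T) :=
  (if k.1 then Z k.2 w.1 - Z k.2 w.2 else Z k.2 w.1 + Z k.2 w.2) / q.
have mZ1 i : measurable_fun setT (fun w : T * T => Z i w.1).
  exact: measurableT_comp.
have mZ2 i : measurable_fun setT (fun w : T * T => Z i w.2).
  exact: measurableT_comp.
have mU k : measurable_fun setT (U k) by case: k => -[] i; [exact: mZ1|exact: mZ2].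
have mV k : measurable_fun setT (V k).
  case: k => -[] i; apply: measurable_funM => //=.
    exact: measurable_funB.
  exact: measurable_funD.
have UV (a : bool * 'I_n -> R) :
    (\int[P \x P]_w (1 + cos (\sum_k a k * U k w))%:E =
     \int[P \x P]_w (1 + cos (\sum_k a k * V k w))%:E)%E.
  pose comb (c : 'I_n -> R) w := \sum_i c i * Z i w.
  have gcomb c : centered_gaussian_rv P (comb c).
    by case: (gH) => _ _ _; apply; exact: (gaussian_space_sum _ _ _ _ _ _ _ _ gH).
  pose A := comb (fun i => a (true, i)).
  pose B := comb (fun i => a (false, i)).
  pose A' := comb (fun i => (a (true, i) + a (false, i)) / q).
  pose B' := comb (fun i => (a (false, i) - a (true, i)) / q).
  have sumb (f : bool * 'I_n -> R) :
      \sum_k f k = \sum_i f (true, i) + \sum_i f (false, i).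
    rewrite (eq_bigr (fun k => f (k.1, k.2))); last by case.
    by rewrite -(pair_bigA _ (fun b i => f (b, i)))/= big_bool.
  have UE w : \sum_k a k * U k w = A w.1 + B w.2 by rewrite sumb.
  have VE w : \sum_k a k * V k w = A' w.1 + B' w.2.
    rewrite sumb -!big_split/=; apply: eq_bigr => i _; rewrite /V/=.
    by field; rewrite gt_eqF.
  have AE w : A' w = (A w + B w) / q.
    by rewrite /A' /A /B /comb -big_split/= mulr_suml; apply: eq_bigr => i _; ring.
  have BE w : B' w = (B w - A w) / q.
    by rewrite /B' /A /B /comb -sumrB/= mulr_suml; apply: eq_bigr => i _; ring.
  (* The rotation acts on the coefficients, and A'^2 + B'^2 = A^2 + B^2 holds pointwise. The two
     sums over independent copies are thus centered Gaussian with the same variance. *)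
  have AB : (\int[P]_w (A w ^+ 2)%:E + \int[P]_w (B w ^+ 2)%:E =
      \int[P]_w (A' w ^+ 2)%:E + \int[P]_w (B' w ^+ 2)%:E)%E.
    have sq0 (W : T -> R) w : setT w -> (0 <= (W w ^+ 2)%:E)%E.
      by move=> _; rewrite lee_fin sqr_ge0.
    have msq c : measurable_fun setT (fun w => (comb c w ^+ 2)%:E).
      by apply/measurable_EFinP/measurable_funX; case: (gcomb c).
    have sqD c c' : (\int[P]_w (comb c w ^+ 2)%:E + \int[P]_w (comb c' w ^+ 2)%:E =
        \int[P]_w ((comb c w ^+ 2)%:E + (comb c' w ^+ 2)%:E))%E.
      by rewrite ge0_integralD//; try exact: sq0; exact: msq.
    rewrite !sqD; apply: eq_integral => w _.
    rewrite -/(A w) -/(B w) -/(A' w) -/(B' w) -!EFinD AE BE !expr_div_n q2; congr EFin.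
    by field.
  have [v vE] : exists v, (\int[P]_w (A w ^+ 2)%:E + \int[P]_w (B w ^+ 2)%:E = v%:E)%E.
    have [x [_ -> _]] := gaussian_sqr_law _ _ _ _ _ (gcomb (fun i => a (true, i))).
    have [y [_ -> _]] := gaussian_sqr_law _ _ _ _ _ (gcomb (fun i => a (false, i))).
    by eexists; rewrite -EFinD.
  have ch : continuous (fun x : R => 1 + cos x).
    by move=> x; apply: cvgD; [exact: cvg_cst|exact: continuous_cos].
  have h0 (x : R) : 0 <= 1 + cos x <= 2.
    by have := cos_le1 x; have := cos_geN1 x; lra.
  transitivity (gauss_int (Num.sqrt v) (fun x => 1 + cos x)).
    under eq_integral do rewrite UE.
    by apply: (gaussian_prod_law _ _ _ _ _ _ v 2 (fun x => 1 + cos x)) => //; exact: gcomb.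
  under eq_integral do rewrite VE.
  apply/esym/(gaussian_prod_law _ _ _ _ _ _ v 2 (fun x => 1 + cos x)) => //.
  - exact: gcomb.
  - exact: gcomb.
  - by rewrite -AB.
(* [D1] constrains only the first copy, [D2] both. The difference of the two boxes is the event that
   the first copy stays within [s] while the second leaves [t]; its probability is determined by box
   probabilities. *)
pose D1 (k : bool * 'I_n) := k.1.
pose D2 (k : bool * 'I_n) := true.
pose b (k : bool * 'I_n) : R := if k.1 then s else t.
have b0 k : 0 <= b k by rewrite /b; case: ifP.
pose box (D : pred (bool * 'I_n)) (W : bool * 'I_n -> T * T -> R) :=
  [set w | forall k, D k -> `|W k w| <= b k].
have box1 : (P \x P)%E (box D1 U) = (P \x P)%E (box D1 V) by exact: box_law.
have box2 : (P \x P)%E (box D2 U) = (P \x P)%E (box D2 V) by exact: box_law.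
have boxD W : (forall k, measurable_fun setT (W k)) ->
    (P \x P)%E (box D1 W `\` box D2 W) = ((P \x P)%E (box D1 W) - (P \x P)%E (box D2 W))%E.
  move=> mW; rewrite measureD//.
  - congr (_ - _)%E; congr (_ _); apply/seteqP; split=> [w []//|w h]; split=> //.
    by move=> k _; exact: h.
  - exact: measurable_box.
  - exact: measurable_box.
  - by rewrite (le_lt_trans (probability_le1 _ _))// ?ltry//; exact: measurable_box.
rewrite -!product_measure1E//.
have -> : inbox s `*` outbox t = box D1 U `\` box D2 U.
  apply/seteqP; split=> -[w1 w2] /=.
    move=> [h1 [i h2]]; split=> [[[] j]//= _|]; first exact: h1.
    by move=> /(_ (false, i) isT); rewrite leNgt h2.
  move=> [h1 /existsNP[[[] i] /not_implyP[_ /negP]]]; rewrite -ltNge /b/= => h2.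
    by have := h1 (true, i) isT; rewrite leNgt h2.
  by split; [move=> j _; exact: (h1 (true, j))|exists i].
rewrite boxD// box1 box2 -boxD//; apply: le_measure; rewrite ?inE.
- by apply: measurableD; exact: measurable_box.
- exact: measurableX.
move=> [w1 w2] [h1 /existsNP[[[] i] /not_implyP[_ /negP]]]; rewrite -ltNge /b/= => h2.
  by have := h1 (true, i) isT; rewrite leNgt h2.
have := h1 (true, i) isT; rewrite /V/= in h2 *; rewrite /b/=.
move: h2; rewrite !normrM normfV (gtr0_norm q0) ltr_pdivlMr// ler_pdivrMr// => h2 h3.
have e1 : (t - s) / q = (t * q - s * q) / 2.
  by rewrite -q2; field; rewrite gt_eqF.
(* If |x - y| <= s sqrt 2 and |x + y| > t sqrt 2, then |x| and |y| both exceed (t - s) / sqrt 2, so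
   both independent copies leave the smaller box. *)
have tri (x y : R) : `|x + y| <= 2 * `|x| + `|x - y|.
  rewrite (_ : x + y = 2 * x - (x - y)); last by ring.
  by apply: le_trans (ler_normB _ _) _; rewrite normrM (ger0_norm (ler0n _ 2)).
split; exists i; rewrite e1 /=.
  by have := tri (Z i w1) (Z i w2); lra.
by have := tri (Z i w2) (Z i w1); rewrite addrC distrC; lra.
Qed.

Let boxP s : P (outbox s) = (1 - P (inbox s))%E.
Proof. by rewrite outboxE probability_setC. Qed.

(** Dividing [fernique_step] by q^2, where q is the probability of the inner box, shows that p(u_k)
    / q is at least squared at each step of u_(k+1) = s + sqrt 2 u_k. It starts at most 1/3, while
    u_k grows only like 2^(k/2); this is a Gaussian tail. *)
Lemma fernique_tail (s t : R) : 0 < s -> 4 * s <= t ->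
  ((3 / 4)%:E <= P (inbox s))%E ->
  (P (outbox t) <= (expR (- (t ^+ 2 / (64 * s ^+ 2))))%:E)%E.
Proof.
move=> s0 st inq.
pose p r := fine (P (outbox r)); pose q := fine (P (inbox s)).
have pE r : P (outbox r) = (p r)%:E by rewrite fineK// fin_num_measure.
have qE : P (inbox s) = q%:E by rewrite fineK// fin_num_measure.
have p0 r : 0 <= p r by rewrite fine_ge0.
have q34 : 3 / 4 <= q by rewrite -lee_fin -qE.
have q1 : q <= 1 by rewrite -lee_fin -qE; exact: probability_le1.
pose r : R := Num.sqrt 2.
have r0 : 0 < r by rewrite sqrtr_gt0.
have r2 : r ^+ 2 = 2 by rewrite sqr_sqrtr.
(* Closed form of the recursion u_0 = s, u_(k+1) = s + sqrt 2 u_k. *)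
pose u k : R := s * (r ^+ k * (2 + r) - (1 + r)).
have rn1 k : 1 <= r ^+ k.
  by rewrite exprn_ege1// -[leLHS]sqrtr1 ler_sqrt// ler1n.
have u0 k : 0 <= u k.
  rewrite mulr_ge0 ?(ltW s0)// subr_ge0.
  by have := rn1 k; nra.
have uS k : (u k.+1 - s) / r = u k.
  apply: (canLR (mulfK (lt0r_neq0 r0))); apply/eqP; rewrite -subr_eq0.
  have -> : u k.+1 - s - u k * r = s * (r ^+ 2 - 2) by rewrite /u exprS; ring.
  by rewrite r2 subrr mulr0.
have pu k : p (u k) <= q * 3^-1 ^+ (2 ^ k).
  elim: k => [|k IH].
    have -> : u 0 = s by rewrite /u expr0; ring.
    have : p s = 1 - q by apply: EFin_inj; rewrite -pE EFinB -qE boxP.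
    by rewrite expn0 expr1 => ->; lra.
  have := fernique_step s (u k.+1) (ltW s0) (u0 _).
  rewrite -/r uS !pE qE -!EFinM lee_fin => h.
  rewrite -(ler_pM2l (lt_le_trans _ q34)); last by lra.
  apply: le_trans h _; apply: (le_trans (ler_pM (p0 _) (p0 _) IH IH)).
  by rewrite expnS mul2n -addnn exprD mulrACA -!mulrA.
(* Since u_k <= 4 s 2^(k/2), the largest [k] with 2^k <= N still has u_k <= t, and N <= 2^(k+1). *)
pose N := (t / (4 * s)) ^+ 2.
have N1 : 1 <= N by rewrite exprn_ege1// ler_pdivlMr ?mul1r// mulr_gt0.
pose k := trunc_log 2 (Num.truncn N).
have tN0 : (0 < Num.truncn N)%N by rewrite truncn_gt0.
have nN : (2 ^ k)%:R <= N.
  rewrite -truncn_ge_nat; last by lra.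
  exact: trunc_logP.
have Nn : N <= (2 ^ k.+1)%:R.
  have := @trunc_log_ltn 2 (Num.truncn N) isT; rewrite -/k => h.
  by rewrite ltW// (lt_le_trans (truncnS_gt _))// ler_nat.
have ut : u k <= t.
  have h : u k <= r ^+ k * (4 * s).
    have := rn1 k; rewrite /u; have : r <= 2.
      by rewrite -[leRHS]ger0_norm// -sqrtr_sqr ler_wsqrtr//; lra.
    rewrite (_ : r ^+ k * (4 * s) = s * (r ^+ k * 4)); last by ring.
    by rewrite ler_pM2l//; nra.
  apply: le_trans h _; rewrite -ler_pdivlMr ?mulr_gt0//.
  have t0 : 0 <= t / (4 * s) by rewrite divr_ge0//; lra.
  rewrite -(@ler_sqr R) ?nnegrE ?exprn_ge0 ?(ltW r0)//.
  by rewrite -exprM mulnC exprM r2 -natrX.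
apply: (@le_trans _ _ (P (outbox (u k)))).
  apply: le_measure; rewrite ?inE// => w [i ti]; exists i.
  exact: le_lt_trans ti.
rewrite pE lee_fin; apply: le_trans (pu k) _.
(* The bound 3^-(2^k) becomes expR (- 2^k / 2), at most expR (- N / 4); this is where 64 = 4 * 16
   comes from. *)
have e3 : 3^-1 <= expR (- 2^-1) :> R.
  by have := expR_ge1Dx (- 2^-1 : R); lra.
apply: (@le_trans _ _ (expR (- 2^-1) ^+ (2 ^ k))).
  rewrite -[leRHS]mul1r ler_pM// ?exprn_ge0//; first by lra.
  by rewrite lerXn2r// nnegrE ?expR_ge0// invr_ge0.
rewrite -expRM_natl ler_expR mulrN lerN2.
have -> : t ^+ 2 / (64 * s ^+ 2) = N / 4.
  by rewrite /N expr_div_n; field; rewrite gt_eqF.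
by move: Nn; rewrite expnS natrM; lra.
Qed.

End fernique.

Lemma measure_exists_gt_le d (T : measurableType d) (R : realType)
    (P : probability T R) (Z : nat -> T -> R) (t : R) (c : \bar R) :
  (forall i, measurable_fun setT (Z i)) ->
  (forall n, P [set w | exists i : 'I_n, (t < `|Z i w|)%R] <= c)%E ->
  (P [set w | exists i, (t < `|Z i w|)%R] <= c)%E.
Proof.
move=> mZ Ec; pose E n := [set w | exists i : 'I_n, t < `|Z i w|].
have mE n : measurable (E n).
  rewrite (_ : E n = \bigcup_(i in [set: 'I_n]) [set w | t < `|Z i w|]).
    apply: fin_bigcup_measurable => // i _.
    by apply: measurable_set_lt => //; exact: measurableT_comp.
  by apply/seteqP; split=> w [i]; [exists i|move=> ?; exists i].
have -> : [set w | exists i, t < `|Z i w|] = \bigcup_n E n.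
  apply/seteqP; split=> [w [i ti]|w [n _ [i ti]]]; last by exists i.
  by exists i.+1 => //; exists (inord i); rewrite inordK.
apply: measure_bigcup_le => // m n mn.
by apply/subsetPset => w [i ti]; exists (widen_ord mn i).
Qed.

Lemma measurable_forall_le d (T : measurableType d) (R : realType)
    (Z : nat -> T -> R) (s : R) : (forall i, measurable_fun setT (Z i)) ->
  measurable [set w | forall i, `|Z i w| <= s].
Proof.
move=> mZ; rewrite (_ : [set _ | _] = \bigcap_i [set w | `|Z i w| <= s]).
  by apply: bigcapT_measurable => i; apply: measurable_set_le => //; exact: measurableT_comp.
by apply/seteqP; split=> w h i; [move=> _; exact: h|exact: (h i I)].
Qed.

Lemma fernique_seq d (T : measurableType d) (R : realType) (P : probability T R)
    (H : (T -> R) -> Prop) (Z : nat -> T -> R) (s t : R) :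
  gaussian_space _ _ _ P H -> (forall i, H (Z i)) -> 0 < s -> 4 * s <= t ->
  ((3 / 4)%:E <= P [set w | forall i, (`|Z i w| <= s)%R])%E ->
  (P [set w | exists i, (t < `|Z i w|)%R] <=
   (expR (- (t ^+ 2 / (64 * s ^+ 2))))%:E)%E.
Proof.
move=> gH HZ s0 st Zs.
have mZ i : measurable_fun setT (Z i) by case: gH => _ _ _ /(_ _ (HZ i))[].
apply: measure_exists_gt_le => // n.
apply: (fernique_tail _ _ _ P H n (fun i => Z i) gH) => //.
apply: le_trans Zs _; apply: le_measure; rewrite ?inE//.
- exact: measurable_forall_le.
- exact: measurable_box.
- by move=> w h i _; exact: h.
Qed.

(** * Linear combinations of a self-similar process *)

Lemma integral_sum_seq d (T : measurableType d) (R : realType)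
    (mu : {measure set T -> \bar R}) (A : eqType) (l : seq A)
    (F : A -> T -> R) (c : A -> R) :
  (forall p, p \in l -> mu.-integrable setT (fun w => (F p w)%:E) /\
    (\int[mu]_w (F p w)%:E = (c p)%:E)%E) ->
  mu.-integrable setT (fun w => (\sum_(p <- l) F p w)%:E) /\
  (\int[mu]_w (\sum_(p <- l) F p w)%:E = (\sum_(p <- l) c p)%:E)%E.
Proof.
elim: l => [|p l IH] Fl.
  have -> : (fun w => (\sum_(p <- [::]) F p w)%:E) = cst 0%E.
    by apply/funext => w; rewrite big_nil.
  by rewrite big_nil integral0; split => //; exact: integrable0.
have [iF cF] := Fl p (mem_head _ _).
have [|iS cS] := IH; first by move=> q ql; apply: Fl; rewrite in_cons ql orbT.
split.
  under eq_fun do rewrite big_cons EFinD.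
  exact: integrableD.
under eq_integral do rewrite big_cons EFinD.
by rewrite big_cons integralD// cF cS.
Qed.

Section process.
Context d (T : measurableType d) (R : realType) (P : probability T R).
Context (X : R -> T -> R) (Rc : R -> R -> R) (rho : R).
Hypothesis gX : centered_gaussian_process P X.
Hypothesis RcE : forall s t : R, 0 <= s -> 0 <= t ->
  (Rc s t)%:E = ('E_P[X s \* X t])%E.
Hypothesis Xss : forall c s t : R, 0 < c -> 0 < s -> 0 < t ->
  Rc (c * s) (c * t) = c `^ (2 * rho) * Rc s t.

Implicit Types l : seq (R * R).

(** Each pair is a coefficient and a time. Keeping the list, and not only the resulting random
    variable, lets a change of time scale act on combinations. *)
Definition comb (l : seq (R * R)) (w : T) := \sum_(p <- l) p.1 * X p.2 w.

Definition process_span (Y : T -> R) :=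
  exists2 l, all (fun p => 0 <= p.2) l & Y = comb l.

Lemma combZ c l w : comb [seq (c * p.1, p.2) | p <- l] w = c * comb l w.
Proof.
by rewrite /comb big_map mulr_sumr; apply: eq_bigr => p _; rewrite mulrA.
Qed.

Lemma comb_gaussian l : all (fun p => 0 <= p.2) l -> centered_gaussian_rv P (comb l).
Proof.
move=> /allP l0; have -> : comb l = fun w => \sum_(i < size l)
    (tnth (in_tuple l) i).1 * X (tnth (in_tuple l) i).2 w.
  by apply/funext => w; rewrite /comb big_tnth.
apply: gX => i; apply: l0; exact: mem_tnth.
Qed.

Lemma gaussian_space_process : gaussian_space _ _ _ P process_span.
Proof.
split.
- by exists [::] => //; apply/funext => w; rewrite /comb big_nil.
- move=> _ _ [l l0 ->] [m m0 ->]; exists (l ++ m); first by rewrite all_cat l0.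
  by apply/funext => w; rewrite /comb big_cat.
- move=> c _ [l l0 ->]; exists [seq (c * p.1, p.2) | p <- l].
    by rewrite all_map.
  by apply/funext => w; rewrite combZ.
- by move=> _ [l l0 ->]; exact: comb_gaussian.
Qed.

Lemma comb_integrable_sqr l : all (fun p => 0 <= p.2) l ->
  P.-integrable setT (fun w => (comb l w ^+ 2)%:E).
Proof.
move=> /comb_gaussian gl; have [t [_ tE _]] := gaussian_sqr_law _ _ _ _ _ gl.
apply/integrableP; split.
  by apply/measurable_EFinP/measurable_funX; case: gl.
under eq_integral do rewrite /= ger0_norm ?sqr_ge0//.
by rewrite tE ltry.
Qed.

Lemma comb1 (s : R) : comb [:: (1, s)] = X s.
Proof. by apply/funext => w; rewrite /comb big_seq1 mul1r. Qed.

Lemma process_measurable (s : R) : 0 <= s -> measurable_fun setT (X s).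
Proof. by move=> s0; rewrite -comb1; have [] := comb_gaussian [:: (1, s)]; rewrite /= ?s0. Qed.

Lemma process_integrable (s t : R) : 0 <= s -> 0 <= t ->
  P.-integrable setT (fun w => (X s w * X t w)%:E) /\
  (\int[P]_w (X s w * X t w)%:E = (Rc s t)%:E)%E.
Proof.
move=> s0 t0; split; last by rewrite RcE// unlock.
have iX (u : R) : 0 <= u -> P.-integrable setT (fun w => (X u w ^+ 2)%:E).
  move=> u0; have := comb_integrable_sqr [:: (1, u)].
  by rewrite comb1 /= u0; exact.
have := integrableD measurableT (iX _ s0) (iX _ t0).
apply: le_integrable => //.
  by apply/measurable_EFinP/measurable_funM; exact: process_measurable.
move=> w _; rewrite -EFinD/= lee_fin [leRHS]ger0_norm ?addr_ge0 ?sqr_ge0// normrM.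
rewrite -(real_normK (num_real (X s w))) -(real_normK (num_real (X t w))).
have := sqr_ge0 (`|X s w| - `|X t w|); have := sqr_ge0 `|X s w|.
have := sqr_ge0 `|X t w|.
by rewrite sqrrB; lra.
Qed.

Lemma comb_sqr l : all (fun p => 0 <= p.2) l ->
  (\int[P]_w (comb l w ^+ 2)%:E =
   (\sum_(p <- l) \sum_(q <- l) p.1 * q.1 * Rc p.2 q.2)%:E)%E.
Proof.
move=> /allP l0.
have lE w : comb l w ^+ 2 =
    \sum_(p <- l) \sum_(q <- l) p.1 * q.1 * (X p.2 w * X q.2 w).
  rewrite expr2 /comb mulr_suml; apply: eq_bigr => p _.
  by rewrite mulr_sumr; apply: eq_bigr => q _; rewrite mulrACA.
under eq_integral do rewrite lE.
have [] // := integral_sum_seq _ _ _ P _ l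
  (fun p w => \sum_(q <- l) p.1 * q.1 * (X p.2 w * X q.2 w))
  (fun p => \sum_(q <- l) p.1 * q.1 * Rc p.2 q.2).
move=> p pl; apply: (integral_sum_seq _ _ _ P _ l
  (fun q w => p.1 * q.1 * (X p.2 w * X q.2 w)) (fun q => p.1 * q.1 * Rc p.2 q.2)).
move=> q ql; have [iX cX] := process_integrable _ _ (l0 p pl) (l0 q ql).
split.
  by under eq_fun do rewrite EFinM; exact: integrableZl.
by under eq_integral do rewrite EFinM; rewrite integralZl// cX.
Qed.

Definition rescale (c : R) (l : seq (R * R)) :=
  [seq (c `^ (- rho) * p.1, c * p.2) | p <- l].

Lemma rescale_sqr (c : R) l : 0 < c -> all (fun p => 0 < p.2) l ->
  (\int[P]_w (comb (rescale c l) w ^+ 2)%:E = \int[P]_w (comb l w ^+ 2)%:E)%E.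
Proof.
move=> c0 l0; rewrite !comb_sqr.
- congr EFin; rewrite /rescale big_map; apply: eq_big_seq => p pl.
  rewrite big_map; apply: eq_big_seq => q ql /=.
  have [p0 q0] := (allP l0 _ pl, allP l0 _ ql).
  have h : c `^ (- rho) * c `^ (- rho) * c `^ (2 * rho) = 1.
    rewrite -!powRD ?(gt_eqF c0) ?implybT//.
    by rewrite (_ : _ + 2 * rho = 0) ?powRr0//; ring.
  rewrite Xss//; move: (c `^ (- rho)) (c `^ (2 * rho)) (Rc p.2 q.2) h => x y z h.
  by rewrite -[RHS]mul1r -h; move: (p.1 : R) (q.1 : R) => u v; ring.
- by apply: sub_all l0 => p /ltW.
- by rewrite all_map; apply: sub_all l0 => p /= p0; rewrite mulr_ge0// ltW.
Qed.

(** One list [l] must serve both sums: the variances before and after rescaling can then be compared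
    by [rescale_sqr]. *)
Lemma rescale_comb_sum (c : R) (I : Type) (r : seq I) (a : I -> R) (m : I -> seq (R * R)) :
  (forall i, all (fun p => 0 < p.2) (m i)) ->
  exists l, [/\ all (fun p => 0 < p.2) l,
    (forall w, \sum_(i <- r) a i * comb (m i) w = comb l w) &
    (forall w, \sum_(i <- r) a i * comb (rescale c (m i)) w = comb (rescale c l) w)].
Proof.
move=> m0; elim: r => [|i r [l [l0 lE lE']]].
  by exists [::]; split => // w; rewrite /comb !big_nil.
exists ([seq (a i * p.1, p.2) | p <- m i] ++ l); split.
- by rewrite all_cat l0 all_map andbT; exact: m0.
- by move=> w; rewrite big_cons lE -combZ /comb big_cat.
- move=> w; rewrite big_cons lE' /comb /rescale map_cat big_cat/=; congr (_ + _).
  rewrite mulr_sumr !big_map; apply: eq_bigr => p _ /=.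
  by rewrite mulrA [a i * _]mulrCA.
Qed.

Lemma rescale_gt0 c l : 0 < c -> all (fun p => 0 < p.2) l ->
  all (fun p => 0 < p.2) (rescale c l).
Proof. by move=> c0 l0; rewrite all_map; apply: sub_all l0 => p /= p0; rewrite mulr_gt0. Qed.

Lemma comb_measurable l : all (fun p => 0 < p.2) l -> measurable_fun setT (comb l).
Proof.
by move=> l0; have [] := @comb_gaussian l (sub_all (fun p => @ltW _ _ _ _) l0).
Qed.

(** Self-similarity is known for the covariance only. It passes to joint laws because every linear
    combination is centered Gaussian and keeps its variance under rescaling, so that [box_law]
    applies. *)
Lemma rescale_box (c t : R) (n : nat) (m : nat -> seq (R * R)) :
  0 < c -> 0 <= t -> (forall i, all (fun p => 0 < p.2) (m i)) ->
  P [set w | exists i : 'I_n, (t < `|comb (rescale c (m i)) w|)%R] =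
  P [set w | exists i : 'I_n, (t < `|comb (m i) w|)%R].
Proof.
move=> c0 t0 m0.
have mm0 i := comb_measurable _ (m0 i).
have mr0 i := comb_measurable _ (rescale_gt0 _ _ c0 (m0 i)).
have exE (Z : nat -> T -> R) : (forall i, measurable_fun setT (Z i)) ->
    P [set w | exists i : 'I_n, (t < `|Z i w|)%R] =
    (1 - P [set w | forall i : 'I_n, true -> (`|Z i w| <= t)%R])%E.
  move=> mZ; rewrite -probability_setC; last by apply: measurable_box.
  congr (P _); apply/seteqP; split=> w /=.
    by move=> [i si] /(_ i isT); rewrite leNgt si.
  by move=> /existsNP[i /not_implyP[_ /negP]]; rewrite -ltNge; exists i.
rewrite (exE (fun i => comb (rescale c (m i))))// (exE (fun i => comb (m i)))//.
congr (1 - _)%E; apply: box_law => // a.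
have [l [l0 lE lE']] := rescale_comb_sum c _ (index_enum 'I_n) a (fun i => m i)
  (fun i => m0 i).
under eq_integral do rewrite lE'.
under [RHS]eq_integral do rewrite lE.
have nneg l' : all (fun p => 0 < p.2) l' -> all (fun p : R * R => 0 <= p.2) l'.
  by apply: sub_all => p /ltW.
have gl := comb_gaussian _ (nneg _ l0).
have gl' := comb_gaussian _ (nneg _ (rescale_gt0 _ _ c0 l0)).
have mcos : measurable_fun setT (fun x : R => 1 + cos x).
  apply: measurable_funD => //; apply: continuous_measurable_fun; exact: continuous_cos.
have cos0 (x : R) : 0 <= 1 + cos x by have := cos_geN1 x; lra.
have sqE := comb_sqr _ (nneg _ l0).
rewrite (gaussian_law_sqr _ _ _ _ _ _ gl sqE (fun x => 1 + cos x))//.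
rewrite -(rescale_sqr c)// in sqE.
by rewrite (gaussian_law_sqr _ _ _ _ _ _ gl' sqE (fun x => 1 + cos x)).
Qed.

(** The level 3/4 has to be checked at scale 1 only, and the tail then holds at every scale [c]. The
    transfer is made on finite subfamilies, with a bound that does not depend on their size. *)
Lemma rescale_tail (s t : R) (m : nat -> seq (R * R)) :
  0 < s -> 4 * s <= t -> (forall i, all (fun p => 0 < p.2) (m i)) ->
  ((3 / 4)%:E <= P [set w | forall i, (`|comb (m i) w| <= s)%R])%E ->
  forall c, 0 < c -> (P [set w | exists i, (t < `|comb (rescale c (m i)) w|)%R] <=
    (expR (- (t ^+ 2 / (64 * s ^+ 2))))%:E)%E.
Proof.
move=> s0 st m0 ms c c0.
have mm0 i := comb_measurable _ (m0 i).
have mr0 i := comb_measurable _ (rescale_gt0 _ _ c0 (m0 i)).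
apply: (measure_exists_gt_le _ _ _ _ (fun i => comb (rescale c (m i)))) => // n.
rewrite (rescale_box c t n m)//; last first.
  by apply: le_trans st; rewrite mulr_ge0// ltW.
apply: le_trans (fernique_seq _ _ _ _ _ (fun i => comb (m i)) s t
  gaussian_space_process _ s0 st ms).
  apply: le_measure; rewrite ?inE.
  - rewrite (_ : [set w | exists i : 'I_n, t < `|comb (m i) w|] =
      \bigcup_(i in [set: 'I_n]) [set w | t < `|comb (m i) w|]).
      apply: fin_bigcup_measurable => // i _.
      by apply: measurable_set_lt => //; exact: measurableT_comp.
    by apply/seteqP; split=> w [i]; [exists i|move=> ?; exists i].
  - rewrite (_ : [set w | exists i, t < `|comb (m i) w|] =
      \bigcup_i [set w | t < `|comb (m i) w|]).
      apply: bigcupT_measurable => i.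
      by apply: measurable_set_lt => //; exact: measurableT_comp.
    by apply/seteqP; split=> w [i]; [exists i|move=> ?; exists i].
  - by move=> w [i ti]; exists i.
by move=> i; exists (m i) => //; apply: sub_all (m0 i) => p /ltW.
Qed.

End process.

Arguments comb {d T R} X l w.
Arguments rescale {R} rho c l.

(** * Upper bound *)

(** Comparison of the series of (n + 2)^-(1 + dl) with the telescoping differences of n^(-dl). Both
    inequalities behind it are instances of 1 + x <= expR x. *)
Lemma expR_ln_telescope {R : realType} (dl : R) (n : nat) : 0 < dl ->
  expR (- ((1 + dl) * ln n.+2%:R)) <=
  dl^-1 * (expR (- (dl * ln n.+1%:R)) - expR (- (dl * ln n.+2%:R))).
Proof.
move=> d0; pose x : R := n.+1%:R; have x0 : 0 < x by rewrite ltr0n.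
have x1E : n.+2%:R = x + 1 :> R by rewrite natr1.
have x10 : 0 < x + 1 by rewrite addr_gt0.
rewrite x1E -/x ler_pdivlMl//.
have -> : expR (- (dl * ln x)) = expR (- (dl * ln (x + 1))) * expR (dl * (ln (x + 1) - ln x)).
  by rewrite -expRD; congr expR; ring.
have -> : expR (- ((1 + dl) * ln (x + 1))) = expR (- (dl * ln (x + 1))) * (x + 1)^-1.
  have -> : (x + 1)^-1 = expR (- ln (x + 1)) by rewrite expRN lnK.
  by rewrite -expRD; congr expR; ring.
rewrite mulrCA -[X in _ - X]mulr1 -mulrBr ler_wpM2l ?expR_ge0//.
have h1 : (x + 1)^-1 <= ln (x + 1) - ln x.
  have := expR_ge1Dx (ln x - ln (x + 1)); rewrite expRD expRN !lnK// => h.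
  have : x / (x + 1) = 1 - (x + 1)^-1 by field; rewrite gt_eqF.
  by lra.
have h2 := expR_ge1Dx (dl * (ln (x + 1) - ln x)).
have : dl * (x + 1)^-1 <= dl * (ln (x + 1) - ln x) by rewrite ler_pM2l.
by lra.
Qed.

Lemma borel_cantelli_power d (T : measurableType d) (R : realType)
    (P : probability T R) (A : nat -> set T) (dl : R) : 0 < dl ->
  (forall n, measurable (A n)) ->
  (forall n, P (A n) <= (expR (- ((1 + dl) * ln n.+2%:R)))%:E)%E ->
  {ae P, forall w, exists N, forall n, (N <= n)%N -> ~ A n w}.
Proof.
move=> d0 mA PA.
have sA : (\sum_(n <oo) P (A n) < +oo)%E.
  apply: (@le_lt_trans _ _ (dl^-1)%:E); last by rewrite ltry.
  apply: lime_le; first exact: is_cvg_nneseries.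
  apply: nearW => n; rewrite big_mkord.
  apply: (@le_trans _ _ (dl^-1 * (1 - expR (- (dl * ln n.+1%:R))))%:E); last first.
    by rewrite lee_fin ler_piMr ?invr_ge0 ?(ltW d0)// gerBl expR_ge0.
  elim: n => [|n IH].
    by rewrite big_ord0 ln1 mulr0 oppr0 expR0 subrr mulr0.
  rewrite big_ord_recr/=; apply: le_trans (leeD IH (PA n)) _.
  rewrite -EFinD lee_fin; have := expR_ln_telescope dl n d0.
  by set u := expR _; set v := expR _; set z := expR _; lra.
exists (lim_sup_set A); split.
- apply: bigcap_measurable => // k _; exact: bigcup_measurable.
- exact: lim_sup_set_cvg0.
move=> w /= /forallNP h N _; apply: contrapT => hN.
by apply: (h N) => n Nn An; apply: hN; exists n.
Qed.

(** Chernoff's bound at the parameter x / tau^2. A positive upper bound [tau] replaces the standard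
    deviation, so that zero variance is included. *)
Lemma gaussian_tail d (T : measurableType d) (R : realType)
    (P : probability T R) (Y : T -> R) (v tau x : R) : centered_gaussian_rv P Y ->
  (\int[P]_w (Y w ^+ 2)%:E)%E = v%:E -> 0 < tau -> v <= tau ^+ 2 -> 0 <= x ->
  (P [set w | (x < Y w)%R] <= (expR (- (x ^+ 2 / (2 * tau ^+ 2))))%:E)%E.
Proof.
move=> gY Yv tau0 vtau x0; have mY := gY.1.
pose l := x / tau ^+ 2.
have l0 : 0 <= l by rewrite divr_ge0// sqr_ge0.
have mexp : measurable_fun setT (fun w => (expR (l * Y w))%:E).
  apply/measurable_EFinP; apply: measurableT_comp => //; exact: measurable_funM.
have mA : measurable [set w | x < Y w] by exact: measurable_set_lt.
rewrite measure_integral_indic//.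
apply: (@le_trans _ _ (\int[P]_w ((expR (- (l * x)))%:E * (expR (l * Y w))%:E))%E).
  apply: ge0_le_integral => //.
  - by apply/measurable_EFinP; exact: measurable_indic.
  - by apply: emeasurable_funM.
  - move=> w _; rewrite -EFinM lee_fin -expRD indicE.
    have [/[!inE] /= xY|_] := boolP (w \in _); last by rewrite expR_ge0.
    rewrite -[leLHS]expR0 ler_expR addrC -mulrBr mulr_ge0// subr_ge0 ltW//.
rewrite ge0_integralZl//.
rewrite (gaussian_mgf _ _ _ _ _ v)// -EFinM lee_fin -expRD ler_expR.
have : l ^+ 2 * v <= l ^+ 2 * tau ^+ 2 by rewrite ler_wpM2l// sqr_ge0.
have -> : l ^+ 2 * tau ^+ 2 = x ^+ 2 / tau ^+ 2 by rewrite /l; field; rewrite gt_eqF.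
have -> : l * x = x ^+ 2 / tau ^+ 2 by rewrite /l; field; rewrite gt_eqF.
have -> : x ^+ 2 / (2 * tau ^+ 2) = (x ^+ 2 / tau ^+ 2) / 2 by field; rewrite gt_eqF.
by lra.
Qed.

(** An enumeration of rationals clipped to [0, 1]; clipping and the default value 0 make every index
    a legitimate sampling point. *)
Definition unit_rat {R : realType} (i : nat) : R :=
  Num.max 0 (Num.min 1 (ratr (odflt 0 (unpickle i)))).

Lemma unit_rat_itv {R : realType} i : 0 <= (unit_rat i : R) <= 1.
Proof. by rewrite /unit_rat le_max lexx/= ge_max ler01/= ge_min lexx. Qed.

Lemma unit_rat_dense {R : realType} (r e : R) : 0 <= r <= 1 -> 0 < e ->
  exists i, `|unit_rat i - r| < e.
Proof.
move=> /andP[r0 r1] e0.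
have [q] := @rat_in_itvoo R (r - e) (r + e) ltac:(lra).
rewrite in_itv/= => /andP[q1 q2].
exists (pickle q); rewrite /unit_rat pickleK/= ltr_norml.
rewrite ltrBDr ltrBlDr lt_max gt_max lt_min gt_min.
apply/andP; split; lra.
Qed.

Lemma lil_normE {R : realType} (rho s : R) : 0 <= s ->
  lil_norm rho s = s `^ rho * Num.sqrt (2 * ln (ln s)).
Proof.
move=> s0; rewrite /lil_norm [2 * _]mulrC -mulrA sqrtrM ?powR_ge0//.
by rewrite [2 * rho]mulrC powRrM powR_mulrn ?powR_ge0// sqrtr_sqr ger0_norm ?powR_ge0.
Qed.

Lemma le_lnln {R : realType} (m s : R) : expR (expR m) <= s ->
  m <= ln (ln s).
Proof.
move=> ms; have s0 : 0 < s by exact: lt_le_trans (expR_gt0 _) ms.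
have h : expR m <= ln s by rewrite -[leLHS]expRK ler_ln ?posrE ?expR_gt0.
by rewrite -[leLHS]expRK ler_ln ?posrE ?expR_gt0// (lt_le_trans (expR_gt0 m)).
Qed.

Lemma exists_exp_between {R : realType} (a s : R) (N : nat) : 1 < a -> a ^+ N <= s ->
  exists k, [/\ (N <= k)%N, a ^+ k <= s & s < a ^+ k.+1].
Proof.
move=> a1 aNs.
have a0 : 0 < a by exact: lt_trans a1.
have ex : exists k, s < a ^+ k.
  exists (Num.truncn (s / (a - 1))).+1.
  apply: (@lt_le_trans _ _ (1 + (Num.truncn (s / (a - 1))).+1%:R * (a - 1))).
    apply: ltr_pwDl => //; rewrite -ler_pdivrMr ?subr_gt0//.
    exact/ltW/truncnS_gt.
  have := @bernoulli_le R (a - 1) (Num.truncn (s / (a - 1))).+1.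
  by rewrite [1 + (a - 1)]addrC subrK; apply; lra.
case: (ex_minnP ex) => -[|k] sk mink.
  have : 1 <= a ^+ N by rewrite exprn_ege1// ltW.
  by move: sk; rewrite expr0; lra.
exists k; split => //.
  by rewrite -ltnS -(ltr_eXn2l a1); exact: le_lt_trans sk.
by rewrite leNgt; apply/negP => /mink; rewrite ltnn.
Qed.

Section upper_bound.
Context d (T : measurableType d) (R : realType) (P : probability T R).
Context (X : R -> T -> R) (Rc : R -> R -> R) (rho : R).
Hypothesis gX : centered_gaussian_process P X.
Hypothesis cX : forall w, {within `[0, +oo[%classic, continuous (fun s => X s w)}.
Hypothesis RcE : forall s t : R, 0 <= s -> 0 <= t ->
  (Rc s t)%:E = ('E_P[X s \* X t])%E.
Hypothesis rho0 : 0 < rho.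
Hypothesis Xss : forall c s t : R, 0 < c -> 0 < s -> 0 < t ->
  Rc (c * s) (c * t) = c `^ (2 * rho) * Rc s t.

Let mX := process_measurable _ _ _ _ _ gX.

Lemma process_continuous (w : T) (s : R) : 0 < s -> X t w @[t --> s] --> X s w.
Proof.
move=> s0; have := cX w; rewrite continuous_within_itvcyP => -[h _].
by apply: h; rewrite in_itv/= s0.
Qed.

Definition osc_comb (a : R) (i : nat) : seq (R * R) :=
  [:: (1, 1 + (a - 1) * unit_rat i); (- 1, 1)].

Lemma comb_osc (a : R) i w :
  comb X (osc_comb a i) w = X (1 + (a - 1) * unit_rat i) w - X 1 w.
Proof. by rewrite /comb /osc_comb big_cons big_seq1/= mul1r mulN1r. Qed.

Lemma osc_comb_gt0 (a : R) i : 1 < a -> all (fun p => 0 < p.2) (osc_comb a i).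
Proof.
move=> a1; rewrite /= ltr01 !andbT ltr_pwDl// mulr_ge0//; first lra.
by case/andP: (unit_rat_itv (R := R) i).
Qed.

Lemma comb_rescale_osc (a c : R) i w :
  comb X (rescale rho c (osc_comb a i)) w =
  c `^ (- rho) * (X (c * (1 + (a - 1) * unit_rat i)) w - X c w).
Proof. by rewrite /comb /osc_comb /= big_cons big_seq1/= !mulr1 mulrN1 mulNr mulrBr. Qed.

(** By continuity at time 1, the indicator of a small oscillation over [1, 1 + 1/(j+1)] tends to 1
    pointwise, and dominated convergence carries this to probabilities. *)
Lemma small_oscillation (e : R) : 0 < e -> exists2 a : R, 1 < a &
  ((3 / 4)%:E <= P [set w | forall i, (`|comb X (osc_comb a i) w| <= e)%R])%E.
Proof.
move=> e0; pose a (j : nat) : R := 1 + j.+1%:R^-1.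
have a1 j : 1 < a j by rewrite ltrDl invr_gt0.
pose A j := [set w | forall i, `|comb X (osc_comb (a j) i) w| <= e].
have mA j : measurable (A j).
  apply: measurable_forall_le => i.
  exact: (comb_measurable _ _ _ _ _ gX _ (osc_comb_gt0 _ i (a1 j))).
have cA : (\int[P]_w (\1_(A j) w)%:E @[j --> \oo] --> \int[P]_w (1 : R)%:E)%E.
  apply: (cvg_integral_bounded _ _ _ P (fun j => \1_(A j)) (fun=> 1)) => //.
  - by move=> j w; rewrite indicE normr_nat lern1 leq_b1.
  - move=> w; apply: cvg_near_cst.
    have /cvgrPdist_le/(_ e e0) := process_continuous w 1 ltr01.
    move=> /nbhs_ballP[r /= r0 rX]; near=> j.
    rewrite indicE mem_set// => i; rewrite comb_osc distrC; apply: rX.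
    rewrite /ball/= opprD addNKr normrN.
    have /andP[u0 u1] := unit_rat_itv (R := R) i.
    rewrite ger0_norm; last by rewrite mulr_ge0// subr_ge0 ltW.
    apply: (@le_lt_trans _ _ (a j - 1)).
      by rewrite ler_piMr// subr_ge0 ltW.
    rewrite /a addrC addKr; near: j; exact: near_infty_natSinv_lt (PosNum r0).
rewrite integral_cst//= probability_setT mul1e in cA.
have : (\forall j \near \oo, (3 / 4)%:E < \int[P]_w (\1_(A j) w)%:E)%E.
  apply: (cA [set y | ((3 / 4)%:E < y)%E]); apply: open_nbhs_nbhs; split; first exact: open_ereal_gt_ereal.
  by rewrite /= lte_fin; lra.
move=> [j _ /(_ j (leqnn j))] /= h; exists (a j) => //.
by apply: ltW; rewrite -measure_integral_indic in h.
Unshelve. all: by end_near.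
Qed.

Let sigma := Num.sqrt (Rc 1 1).

Lemma process_sqr (s : R) : 0 < s ->
  (\int[P]_w (X s w ^+ 2)%:E = (s `^ (2 * rho) * Rc 1 1)%:E)%E.
Proof.
move=> s0; have [_] := process_integrable _ _ _ P X Rc gX RcE s s (ltW s0) (ltW s0).
by under eq_integral do rewrite -expr2; rewrite -(Xss s 1 1)// mulr1.
Qed.

Lemma Rc11_ge0 : 0 <= Rc 1 1.
Proof.
have := process_sqr 1 ltr01; rewrite powR1 mul1r -lee_fin => <-.
by apply: integral_ge0 => w _; rewrite lee_fin sqr_ge0.
Qed.

(* On the block [c, a c] the process stays below its value at c plus the
   oscillation, which is controlled on a dense set of points. *)
Lemma block_bound (a c t : R) (w : T) (s : R) : 1 < a -> 0 < c -> 0 <= t ->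
  (forall i, `|comb X (rescale rho c (osc_comb a i)) w| <= t) ->
  c <= s -> s <= c * a -> X s w <= X c w + c `^ rho * t.
Proof.
move=> a1 c0 t0 osc cs sa.
have cr : 0 < c `^ rho by exact: powR_gt0.
have s0 : 0 < s by exact: lt_le_trans cs.
rewrite leNgt; apply/negP => Xs.
have /cvgrPdist_lt/(_ (X s w - (X c w + c `^ rho * t))) := process_continuous w s s0.
rewrite subr_gt0 => /(_ Xs) /nbhs_ballP[e /= e0 eX].
pose r := (s / c - 1) / (a - 1).
have a10 : 0 < a - 1 by rewrite subr_gt0.
have r01 : 0 <= r <= 1.
  rewrite /r divr_ge0 ?(ltW a10)//=; last by rewrite subr_ge0 ler_pdivlMr// mul1r.
  by rewrite ler_pdivrMr// mul1r lerB// ler_pdivrMr// mulrC.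
have sE : s = c * (1 + (a - 1) * r).
  by rewrite /r; field; rewrite !gt_eqF.
have e'0 : 0 < e / (c * (a - 1)) by rewrite divr_gt0// mulr_gt0.
have [i ri] := unit_rat_dense r _ r01 e'0.
have := eX (c * (1 + (a - 1) * unit_rat i)); rewrite /ball/=.
have -> : s - c * (1 + (a - 1) * unit_rat i) = - (c * (a - 1) * (unit_rat i - r)).
  by rewrite {1}sE; ring.
rewrite normrN normrM (gtr0_norm (mulr_gt0 c0 a10)) mulrC -ltr_pdivlMr ?mulr_gt0//.
move=> /(_ ri) /ltr_normlW h.
have := osc i; rewrite comb_rescale_osc powRN normrM normfV (gtr0_norm cr).
rewrite ler_pdivrMl// => /ler_normlW; lra.
Qed.

Lemma lil_upper (L : R) : sigma < L ->
  {ae P, forall w, exists S, forall s, S <= s -> X s w <= L * lil_norm rho s}.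
Proof.
move=> sL; have s0 : 0 <= sigma by exact: sqrtr_ge0.
(* Chosen so that e <= 1 and (sigma + 2 e)(1 + e) <= L: one [e] is spent on the endpoint, one on the
   oscillation and one on replacing ln n by ln ln s. *)
pose e := (L - sigma) / (sigma + 4 + (L - sigma)).
have e0 : 0 < e by rewrite divr_gt0//; lra.
have e1 : e <= 1 by rewrite ler_pdivrMr; lra.
have eL : (sigma + 2 * e) * (1 + e) <= L.
  have h : e * (sigma + 4) <= L - sigma.
    rewrite /e mulrAC ler_pdivrMr; last lra.
    by rewrite ler_pM2l; lra.
  by nra.
(* With s = e / 8 the constant 64 of the tail cancels, and the exponent at level [e * t n] is
   exactly t_n^2 = 2 ln (n + 2), which is summable. *)
have e80 : 0 < e / 8 by rewrite divr_gt0.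
have [a a1 Pa] := small_oscillation _ e80.
have a0 : 0 < a by exact: lt_trans a1.
(* The shift by 2 keeps ln (n + 2) bounded away from 0, so that [t n] is at least 1. *)
pose c n : R := a ^+ n.+2.
have c0 n : 0 < c n by rewrite exprn_gt0.
pose lk n : R := ln n.+2%:R.
have lk0 n : 2^-1 <= lk n.
  have := expR_ge1Dx (- lk n); rewrite expRN lnK ?posrE// => h.
  have : n.+2%:R^-1 <= 2^-1 :> R by rewrite lef_pV2 ?posrE// ler_nat.
  by move: h; move: (n.+2%:R^-1 : R) (lk n) => i l; lra.
pose t n : R := Num.sqrt (2 * lk n).
have t2 n : t n ^+ 2 = 2 * lk n.
  by rewrite sqr_sqrtr//; have := lk0 n; lra.
have t0 n : 0 <= t n by exact: sqrtr_ge0.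
have t1 n : 1 <= t n.
  rewrite -(@ler_sqr R) ?nnegrE// t2 expr1n; have := lk0 n; lra.
pose A n := [set w | (sigma + e) * t n < (c n) `^ (- rho) * X (c n) w].
pose B n := [set w | exists i, e * t n < `|comb X (rescale rho (c n) (osc_comb a i)) w|].
have mXc n : measurable_fun setT (fun w => (c n) `^ (- rho) * X (c n) w).
  by apply: measurable_funM => //; exact: mX (ltW (c0 n)).
have mO n i : measurable_fun setT (comb X (rescale rho (c n) (osc_comb a i))).
  by apply: (comb_measurable _ _ _ _ _ gX); apply: rescale_gt0 => //; exact: osc_comb_gt0.
have mA n : measurable (A n) by exact: measurable_set_lt.
have mB n : measurable (B n).
  rewrite (_ : B n = ~` [set w | forall i,
      `|comb X (rescale rho (c n) (osc_comb a i)) w| <= e * t n]).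
    by apply: measurableC; exact: measurable_forall_le.
  apply/seteqP; split=> w /=.
    by move=> [i si] /(_ i); rewrite leNgt si.
  by move=> /existsNP[i /negP]; rewrite -ltNge; exists i.
(* Lies strictly between sigma and sigma + e, and is positive even if sigma = 0. The square of
   (sigma + e) / tau = 1 + (e / tau) / 2 is at least 1 + e / tau, the exponent needed for
   Borel-Cantelli. *)
pose tau := sigma + e / 2.
have tau0 : 0 < tau by rewrite /tau; lra.
have dl0 : 0 < e / tau by rewrite divr_gt0.
have PA n : (P (A n) <= (expR (- ((1 + e / tau) * ln n.+2%:R)))%:E)%E.
  have gY : centered_gaussian_rv P (comb X (rescale rho (c n) [:: (1, 1)])).
    by apply: comb_gaussian => //=; rewrite mulr1 ltW.
  have YE w : comb X (rescale rho (c n) [:: (1, 1)]) w = (c n) `^ (- rho) * X (c n) w.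
    by rewrite /comb /rescale/= big_seq1/= !mulr1.
  have Yv : (\int[P]_w (comb X (rescale rho (c n) [:: (1, 1)]) w ^+ 2)%:E = (Rc 1 1)%:E)%E.
    rewrite (rescale_sqr _ _ _ _ _ _ _ gX RcE Xss)//=; last by rewrite ltr01.
    by rewrite comb1 process_sqr// powR1 mul1r.
  have vtau : Rc 1 1 <= tau ^+ 2.
    by rewrite -[leLHS](sqr_sqrtr Rc11_ge0) -/sigma /tau; nra.
  have x0 : 0 <= (sigma + e) * t n by rewrite mulr_ge0//; lra.
  have := gaussian_tail _ _ _ _ _ _ tau _ gY Yv tau0 vtau x0.
  rewrite (_ : [set w | _] = A n); last by apply/seteqP; split => w /=; rewrite YE.
  move=> /le_trans; apply; rewrite lee_fin ler_expR lerN2 exprMn t2.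
  rewrite [leRHS](_ : _ = ((sigma + e) / tau) ^+ 2 * lk n); last by field; rewrite gt_eqF.
  rewrite -/(lk n) ler_wpM2r//; first by have := lk0 n; lra.
  have -> : (sigma + e) / tau = 1 + (e / tau) / 2.
    by rewrite /tau; field; rewrite gt_eqF; rewrite /tau in tau0; lra.
  by rewrite sqrrD; have := sqr_ge0 (e / tau / 2); lra.
have PB n : (P (B n) <= (expR (- ((1 + 1) * ln n.+2%:R)))%:E)%E.
  have et : 4 * (e / 8) <= e * t n by have := t1 n; nra.
  apply: le_trans (rescale_tail _ _ _ _ _ _ _ gX RcE Xss _ _ _ e80 et
    (fun i => osc_comb_gt0 _ i a1) Pa _ (c0 n)) _.
  rewrite lee_fin ler_expR lerN2 exprMn t2 -/(lk n).
  by rewrite [leRHS](_ : _ = (1 + 1) * lk n)//; field; rewrite gt_eqF.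
have bcA := borel_cantelli_power _ _ _ _ _ _ dl0 mA PA.
have bcB := borel_cantelli_power _ _ _ _ _ _ ltr01 mB PB.
apply: filterS2 bcA bcB => w [N1 HA] [N2 HB].
pose N := maxn N1 N2.
(* Since ln ln a^(n+2) = ln (n + 2) + ln ln a, the constant ln ln a, negative for [a] close to 1, is
   absorbed into e ln ln s once ln ln s >= m. *)
pose m : R := Num.max 0 (`|ln (ln a)| / e).
exists (Num.max (a ^+ N.+2) (expR (expR m))) => s.
rewrite ge_max => /andP[aNs /le_lnln ms].
have [k [Nk aks sak]] := exists_exp_between _ _ _ a1 aNs.
move: k Nk aks sak => [//|[//|n]]; rewrite !ltnS => Nn aks sak.
have s_gt0 : 0 < s by exact: lt_le_trans (c0 n) aks.
have {}HA := HA n (leq_trans (leq_maxl _ _) Nn).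
have {}HB := HB n (leq_trans (leq_maxr _ _) Nn).
have oscb i : `|comb X (rescale rho (c n) (osc_comb a i)) w| <= e * t n.
  by rewrite leNgt; apply/negP => h; apply: HB; exists i.
have XsC := block_bound a (c n) (e * t n) w s a1 (c0 n) (mulr_ge0 (ltW e0) (t0 n)) oscb aks.
rewrite -exprSr in XsC; have {}XsC := XsC (ltW sak).
have Xc : X (c n) w <= c n `^ rho * ((sigma + e) * t n).
  have : c n `^ (- rho) * X (c n) w <= (sigma + e) * t n.
    by rewrite leNgt; apply/negP.
  by rewrite powRN ler_pdivrMl// powR_gt0.
have m0 : 0 <= m by rewrite le_max lexx.
have l0 : 0 <= ln (ln s) by exact: le_trans ms.
have lns : lk n <= (1 + e) * ln (ln s).
  have lna : 0 < ln a by rewrite ln_gt0.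
  have h1 : lk n + ln (ln a) <= ln (ln s).
    rewrite /lk -lnM ?posrE// ler_ln ?posrE ?mulr_gt0//.
      by rewrite mulr_natl -lnXn// ler_ln// posrE exprn_gt0.
    by rewrite ln_gt0// (lt_le_trans _ aks)// exprn_egt1.
  have h2 : - ln (ln a) <= e * ln (ln s).
    apply: le_trans (ler_wpM2l (ltW e0) ms).
    apply: (@le_trans _ _ `|ln (ln a)|); first by rewrite -normrN ler_norm.
    by rewrite -ler_pdivrMl// mulrC le_max lexx orbT.
  by lra.
have tn : t n <= (1 + e) * Num.sqrt (2 * ln (ln s)).
  rewrite -(@ler_sqr R) ?nnegrE ?mulr_ge0 ?sqrtr_ge0//; last lra.
  rewrite t2 exprMn sqr_sqrtr; last by rewrite mulr_ge0.
  by nra.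
have cs : c n `^ rho <= s `^ rho by rewrite ge0_ler_powR ?nnegrE ?(ltW (c0 n)) ?(ltW s_gt0) ?(ltW rho0).
rewrite lil_normE ?(ltW s_gt0)//.
have cr0 : 0 <= c n `^ rho by exact: powR_ge0.
have q0 : 0 <= Num.sqrt (2 * ln (ln s)) by exact: sqrtr_ge0.
set q := Num.sqrt _ in tn q0 *.
apply: (@le_trans _ _ (s `^ rho * ((sigma + 2 * e) * t n))).
  apply: le_trans XsC _.
  apply: (@le_trans _ _ (c n `^ rho * ((sigma + 2 * e) * t n))); first by nra.
  by rewrite ler_wpM2r// mulr_ge0//; lra.
rewrite [leRHS]mulrCA ler_wpM2l ?powR_ge0//.
apply: (@le_trans _ _ ((sigma + 2 * e) * ((1 + e) * q))).
  by rewrite ler_wpM2l//; lra.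
by rewrite mulrA ler_wpM2r.
Qed.

End upper_bound.

(** * Lower bound *)

(** Integrability travels with the value because the second moment argument integrates a sum with
    negative terms. *)
Definition has_expectation d (T : measurableType d) (R : realType)
    (P : probability T R) (f : T -> R) (c : R) :=
  P.-integrable setT (fun w => (f w)%:E) /\ (\int[P]_w (f w)%:E = c%:E)%E.

Section has_expectation.
Context d (T : measurableType d) (R : realType) (P : probability T R).
Implicit Types f g : T -> R.

Lemma has_expectation_cst c : has_expectation d T R P (fun=> c) c.
Proof.
split; first exact: finite_measure_integrable_cst.
by rewrite integral_cst//= probability_setT mule1.
Qed.

Lemma has_expectationD f g a b : has_expectation d T R P f a ->
  has_expectation d T R P g b -> has_expectation d T R P (fun w => f w + g w) (a + b).
Proof.
move=> [fi fa] [gi gb]; split.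
  by under eq_fun do rewrite EFinD; exact: integrableD.
by under eq_integral do rewrite EFinD; rewrite integralD// fa gb.
Qed.

Lemma has_expectationZ f a c : has_expectation d T R P f a ->
  has_expectation d T R P (fun w => c * f w) (c * a).
Proof.
move=> [fi fa]; split.
  by under eq_fun do rewrite EFinM; exact: integrableZl.
by under eq_integral do rewrite EFinM; rewrite integralZl// fa.
Qed.

Lemma has_expectation_sum (I : finType) (f : I -> T -> R) (a : I -> R) :
  (forall i, has_expectation d T R P (f i) (a i)) ->
  has_expectation d T R P (fun w => \sum_i f i w) (\sum_i a i).
Proof.
move=> fa; apply: (integral_sum_seq _ _ _ P _ (index_enum I)).
by move=> i _; exact: fa.
Qed.

Lemma has_expectation_ge0 f c : measurable_fun setT f -> (forall w, 0 <= f w) ->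
  (\int[P]_w (f w)%:E = c%:E)%E -> has_expectation d T R P f c.
Proof.
move=> mf f0 fc; split => //; apply/integrableP; split.
  exact/measurable_EFinP.
by under eq_integral do rewrite /= ger0_norm//; rewrite fc ltry.
Qed.

Lemma le_has_expectation f g a b : has_expectation d T R P f a ->
  has_expectation d T R P g b -> (forall w, f w <= g w) -> a <= b.
Proof.
move=> [fi fa] [gi gb] fg; rewrite -lee_fin -fa -gb.
by apply: le_integral => // w _; rewrite lee_fin.
Qed.

(* Truncating the exponential weights expR (l * V i) to (1 - ka) l < V i <= (1 + ka) l
   makes the second moment method work over the whole range l ^ 2 < 2 ln N; every
   truncation is bounded by an exponential of V i. *)
Lemma truncated_second_moment (N : nat) (V : 'I_N -> T -> R) (l ka b : R)
    (c : 'I_N -> 'I_N -> R) : (0 < N)%N ->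
  (forall i, measurable_fun setT (V i)) -> 0 <= l -> 0 < ka -> ka <= 1 ->
  (forall i m, has_expectation d T R P (fun w => expR (m * V i w)) (expR (m ^+ 2 / 2))) ->
  (forall i j, i != j ->
    has_expectation d T R P (fun w => expR (l * (V i w + V j w))) (c i j)) ->
  (forall i j, i != j -> c i j <= expR (l ^+ 2 * (1 + b))) ->
  (P [set w | forall i, true -> (V i w <= (1 - ka) * l)%R] <=
   (4 * expR (- (ka ^+ 2 * l ^+ 2 / 2)) + expR ((2^-1 + ka) * l ^+ 2) / N%:R +
    (expR (l ^+ 2 * b) - 1))%:E)%E.
Proof.
move=> N0 mV l0 ka0 ka1 Vexp Vpair cb.
pose n1 : R := N%:R^-1.
have n10 : 0 < n1 by rewrite invr_gt0 ltr0n.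
have NN : N%:R * n1 = 1 by rewrite divff// pnatr_eq0 -lt0n.
pose no := [set w | forall i, true -> V i w <= (1 - ka) * l].
have mno : measurable no.
  rewrite (_ : no = \bigcap_(i in [set: 'I_N]) [set w | V i w <= (1 - ka) * l]).
    by apply: fin_bigcap_measurable => // i _; exact: measurable_set_le.
  by apply/seteqP; split=> w h i; [move=> _; exact: h|move=> _; exact: (h i I)].
pose ex (m q : R) (i : 'I_N) (w : T) := expR q * expR (m * V i w).
have hex m q i : has_expectation d T R P (ex m q i) (expR (q + m ^+ 2 / 2)).
  by rewrite expRD; exact: has_expectationZ.
(* [G] is the exponential weight normalized to mean 1. Multiplying it by an exponential that is at
   least 1 below (resp. above) the truncation window gives [A] (resp. [B]), which dominates [G]
   there. In the same way [C] dominates the square of [G] below the upper end of the window. *)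
pose G := ex l (- (l ^+ 2 / 2)).
pose A := ex ((1 - ka) * l) ((ka - ka ^+ 2 - 2^-1) * l ^+ 2).
pose B := ex ((1 + ka) * l) (- ((2^-1 + ka + ka ^+ 2) * l ^+ 2)).
pose C := ex ((1 + ka) * l) (- (ka ^+ 2 * l ^+ 2)).
pose e1 := expR (- (ka ^+ 2 * l ^+ 2 / 2)).
have hG i : has_expectation d T R P (G i) 1.
  by have := hex l (- (l ^+ 2 / 2)) i; rewrite addNr expR0.
have hA i : has_expectation d T R P (A i) e1.
  have -> : e1 = expR ((ka - ka ^+ 2 - 2^-1) * l ^+ 2 + ((1 - ka) * l) ^+ 2 / 2).
    by congr expR; field.
  exact: hex.
have hB i : has_expectation d T R P (B i) e1.
  have -> : e1 = expR (- ((2^-1 + ka + ka ^+ 2) * l ^+ 2) + ((1 + ka) * l) ^+ 2 / 2).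
    by congr expR; field.
  exact: hex.
pose e3 := expR ((2^-1 + ka - ka ^+ 2 / 2) * l ^+ 2).
have hC i : has_expectation d T R P (C i) e3.
  have -> : e3 = expR (- (ka ^+ 2 * l ^+ 2) + ((1 + ka) * l) ^+ 2 / 2).
    by congr expR; field.
  exact: hex.
pose K i j w := if i == j then C i w else expR (- l ^+ 2) * expR (l * (V i w + V j w)).
pose k i j := if i == j then e3 else expR (- l ^+ 2) * c i j.
have hK i j : has_expectation d T R P (K i j) (k i j).
  rewrite /K /k; have [_|ij] := eqVneq i j; first exact: hC.
  exact/has_expectationZ/Vpair.
(* With S the average of the truncated weights, [W] bounds (1 - S)^2 from above term by term. If no
   [V i] exceeds (1 - ka) l then S = 0, so (1 - S)^2 dominates the indicator of this event. *)
pose W w := 1 + (2 * n1) * \sum_i (A i w + (B i w + (-1) * G i w)) +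
  n1 ^+ 2 * \sum_i \sum_j K i j w.
have hW : has_expectation d T R P W
    (1 + (2 * n1) * \sum_(i < N) (e1 + (e1 + (-1) * 1)) + n1 ^+ 2 * \sum_i \sum_j k i j).
  apply: has_expectationD.
    apply: has_expectationD; first exact: has_expectation_cst.
    apply: has_expectationZ; apply: has_expectation_sum => i.
    by apply: has_expectationD => //; apply: has_expectationD => //; exact: has_expectationZ.
  apply: has_expectationZ; apply: has_expectation_sum => i.
  by apply: has_expectation_sum => j; exact: hK.
have hno : has_expectation d T R P \1_no (fine (P no)).
  apply: has_expectation_ge0 => //.
  by rewrite -measure_integral_indic// fineK// fin_num_measure.
have noW w : \1_no w <= W w.
  pose g i := if ((1 - ka) * l < V i w) && (V i w <= (1 + ka) * l) then G i w else 0.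
  have G0 i : 0 <= G i w by rewrite mulr_ge0 ?expR_ge0.
  have A0 i : 0 <= A i w by rewrite mulr_ge0 ?expR_ge0.
  have B0 i : 0 <= B i w by rewrite mulr_ge0 ?expR_ge0.
  have C0 i : 0 <= C i w by rewrite mulr_ge0 ?expR_ge0.
  have g0 i : 0 <= g i by rewrite /g; case: ifP.
  have gG i : g i <= G i w by rewrite /g; case: ifP.
  have Gg i : G i w - A i w - B i w <= g i.
    rewrite /g; case: ifPn => [_|]; first by rewrite -addrA gerDl -opprD oppr_le0 addr_ge0.
    rewrite negb_and -leNgt -ltNge => /orP[h|h].
      suff : G i w <= A i w by have := B0 i; lra.
      rewrite /G /A /ex -!expRD ler_expR.
      have : 0 <= ka * l * ((1 - ka) * l - V i w) by rewrite !mulr_ge0 ?subr_ge0// ltW.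
      by lra.
    suff : G i w <= B i w by have := A0 i; lra.
    rewrite /G /B /ex -!expRD ler_expR.
    have : 0 <= ka * l * (V i w - (1 + ka) * l) by rewrite !mulr_ge0 ?subr_ge0// ltW.
    by lra.
  have gC i : g i * g i <= C i w.
    rewrite /g; case: ifPn => [/andP[_ h]|_]; last by rewrite mulr0.
    rewrite /G /C /ex -!expRD ler_expR.
    have : 0 <= (1 - ka) * l * ((1 + ka) * l - V i w) by rewrite !mulr_ge0 ?subr_ge0.
    by lra.
  have gK i j : g i * g j <= K i j w.
    rewrite /K; have [<-//|ij] := eqVneq i j.
    apply: le_trans (ler_pM (g0 i) (g0 j) (gG i) (gG j)) _.
    by rewrite /G /ex -!expRD ler_expR; lra.
  pose S := n1 * \sum_i g i.
  have S2 : S ^+ 2 <= n1 ^+ 2 * \sum_i \sum_j K i j w.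
    rewrite /S exprMn ler_wpM2l ?sqr_ge0// expr2 mulr_suml.
    by apply: ler_sum => i _; rewrite mulr_sumr; exact: ler_sum.
  have S1 : - S <= n1 * \sum_i (A i w + (B i w + (-1) * G i w)).
    rewrite -mulrN ler_wpM2l ?(ltW n10)// -sumrN; apply: ler_sum => i _.
    by have := Gg i; lra.
  apply: (@le_trans _ _ ((1 - S) ^+ 2)); last by rewrite /W; lra.
  rewrite indicE; case: (boolP (w \in no)) => [|_]; last by rewrite sqr_ge0.
  rewrite inE => hw; have -> : S = 0; last by rewrite subr0 expr1n.
  rewrite /S big1 ?mulr0// => i _; rewrite /g ltNge.
  by have -> := hw i isT.
have := le_has_expectation _ _ _ _ hno hW noW.
rewrite -[P no]fineK ?fin_num_measure// lee_fin => /le_trans; apply.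
have sk : \sum_i \sum_j k i j <= N%:R * e3 + N%:R ^+ 2 * expR (l ^+ 2 * b).
  apply: (@le_trans _ _ (\sum_(i < N) (e3 + N%:R * expR (l ^+ 2 * b)))).
    apply: ler_sum => i _.
    apply: (@le_trans _ _ (\sum_(j < N) ((if i == j then e3 else 0) + expR (l ^+ 2 * b)))).
      apply: ler_sum => j _; rewrite /k; case: eqVneq => [_|ij].
        by rewrite lerDl expR_ge0.
      rewrite add0r; apply: le_trans (ler_wpM2l (expR_ge0 _) (cb _ _ ij)) _.
      by rewrite -expRD ler_expR; lra.
    rewrite big_split/= -big_mkcond/= (eq_bigl (pred1 i)); last by move=> j; rewrite eq_sym.
    by rewrite big_pred1_eq lerD2l sumr_const card_ord mulr_natl.
  by rewrite sumr_const card_ord -[leLHS]mulr_natl mulrDr mulrA expr2.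
have e31 : e3 <= expR ((2^-1 + ka) * l ^+ 2).
  by rewrite ler_expR ler_wpM2r ?sqr_ge0//; have := sqr_ge0 ka; lra.
have h1 : 2 * n1 * \sum_(i < N) (e1 + (e1 + -1 * 1)) = 4 * e1 - 2.
  rewrite sumr_const card_ord -[_ *+ N]mulr_natl.
  have -> : 2 * n1 * (N%:R * (e1 + (e1 + -1 * 1))) = (N%:R * n1) * (4 * e1 - 2) by ring.
  by rewrite NN mul1r.
have h2 : n1 ^+ 2 * \sum_i \sum_j k i j <= e3 * n1 + expR (l ^+ 2 * b).
  apply: le_trans (ler_wpM2l (sqr_ge0 n1) sk) _.
  have -> : n1 ^+ 2 * (N%:R * e3 + N%:R ^+ 2 * expR (l ^+ 2 * b)) =
    (N%:R * n1) * (e3 * n1) + (N%:R * n1) ^+ 2 * expR (l ^+ 2 * b) by ring.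
  by rewrite NN expr1n !mul1r.
have h3 : e3 * n1 <= expR ((2^-1 + ka) * l ^+ 2) * n1 by rewrite ler_pM2r.
by rewrite h1 -/e1 -/n1; lra.
Qed.

End has_expectation.

(** * Limits of powers and logarithms of the spacing *)

Lemma cvg_mul_ln_natr {R : realType} (c : R) : 0 < c ->
  c * ln n%:R @[n --> \oo] --> +oo.
Proof.
move=> c0; apply/cvgryPge => A; near=> n.
rewrite -ler_pdivrMl// mulrC.
have n0 : 0 < n%:R :> R by near: n; exact: nbhs_infty_gtr.
have nA : expR (A / c) <= n%:R :> R by near: n; exact: nbhs_infty_ger.
by rewrite -[leLHS]expRK ler_ln ?posrE ?expR_gt0.
Unshelve. all: by end_near. Qed.

Lemma cvg_expR_ln_natr {R : realType} (c : R) : 0 < c ->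
  expR (- (c * ln n%:R)) @[n --> \oo] --> (0 : R).
Proof.
move=> c0; apply: (cvg_comp (fun n => c * ln n%:R) (fun x : R => expR (- x))).
  exact: cvg_mul_ln_natr.
exact: cvgr_expR.
Qed.

Lemma cvg_ln_expR_ln_natr {R : realType} (c : R) : 0 < c ->
  ln n%:R * expR (- (c * ln n%:R)) @[n --> \oo] --> (0 : R).
Proof.
move=> c0; have c20 : 0 < c / 2 by rewrite divr_gt0.
apply: (@squeeze_cvgr _ _ _ _ (cst 0)
  (fun n => (c / 2)^-1 * expR (- (c / 2 * ln n%:R)))); last 2 first.
- exact: cvg_cst.
- rewrite -[X in _ --> X](mulr0 (c / 2)^-1); apply: cvgM; first exact: cvg_cst.
  exact: cvg_expR_ln_natr.
near=> n.
have n1 : 1 <= n%:R :> R by near: n; exact: nbhs_infty_ger.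
have l0 : 0 <= ln n%:R :> R by exact: ln_ge0.
rewrite mulr_ge0 ?expR_ge0//= ler_pdivlMl//.
have -> : expR (- (c * ln n%:R)) = expR (- (c / 2 * ln n%:R)) * expR (- (c / 2 * ln n%:R)).
  by rewrite -expRD; congr expR; field.
rewrite !mulrA -[leRHS]mul1r ler_wpM2r ?expR_ge0//.
rewrite expRN ler_pdivrMr ?expR_gt0// mul1r.
by have := expR_ge1Dx (c / 2 * ln n%:R : R); lra.
Unshelve. all: by end_near. Qed.

Lemma cvg_second_moment_bound {R : realType} (c1 c2 a eta : R) :
  0 < c1 -> 0 < c2 -> 0 < eta ->
  4 * expR (- (c1 * ln n%:R)) + expR (- (c2 * ln n%:R)) +
  (expR (a * (ln n%:R * expR (- (eta * ln n%:R)))) - 1) @[n --> \oo] --> (0 : R).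
Proof.
move=> c10 c20 eta0.
rewrite (_ : 0 = 4 * 0 + 0 + (expR (a * 0) - 1)); last by rewrite !mulr0 expR0; ring.
apply: cvgD; first apply: cvgD.
- by apply: cvgM; [exact: cvg_cst|exact: cvg_expR_ln_natr].
- exact: cvg_expR_ln_natr.
apply: cvgB; last exact: cvg_cst.
apply: (cvg_comp _ expR); last exact: continuous_expR.
by apply: cvgM; [exact: cvg_cst|exact: cvg_ln_expR_ln_natr].
Qed.

Lemma powR_expR {R : realType} (u a : R) : expR u `^ a = expR (a * u).
Proof. by rewrite /powR gt_eqF ?expR_gt0// expRK. Qed.

Section lower_bound.
Context d (T : measurableType d) (R : realType) (P : probability T R).
Context (X : R -> T -> R) (Rc : R -> R -> R) (rho eta : R).
Hypothesis gX : centered_gaussian_process P X.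
Hypothesis RcE : forall s t : R, 0 <= s -> 0 <= t ->
  (Rc s t)%:E = ('E_P[X s \* X t])%E.
Hypothesis Xss : forall c s t : R, 0 < c -> 0 < s -> 0 < t ->
  Rc (c * s) (c * t) = c `^ (2 * rho) * Rc s t.
Hypothesis eta0 : 0 < eta.
Hypothesis decay : exists C M : R, 1 <= M /\ forall x, M <= x ->
  `| x `^ (- rho) * Rc 1 x | <= C * (ln x) `^ (- eta).

Let sigma := Num.sqrt (Rc 1 1).

Lemma Rc_sym (s t : R) : 0 <= s -> 0 <= t -> Rc s t = Rc t s.
Proof.
move=> s0 t0; apply: EFin_inj; rewrite !RcE//; congr expectation.
by apply/funext => w /=; rewrite mulrC.
Qed.

(** The Lamperti transform of the process, normalized by sigma: in the logarithmic time [u]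
    self-similarity becomes stationarity of the covariance. *)
Let nV (u : R) := [:: (sigma^-1 * expR (- (rho * u)), expR u)].

Let nVE u w : comb X (nV u) w = sigma^-1 * expR (- (rho * u)) * X (expR u) w.
Proof. by rewrite /comb /nV big_seq1. Qed.

Let r (u v : R) := sigma^-1 * expR (- (rho * u)) * (sigma^-1 * expR (- (rho * v))) *
  Rc (expR u) (expR v).

Let rC u v : r u v = r v u.
Proof. by rewrite /r Rc_sym ?expR_ge0// [_ * (sigma^-1 * _)]mulrC. Qed.

Let r1 u : 0 < Rc 1 1 -> r u u = 1.
Proof.
move=> Rc0; rewrite /r.
have := Xss (expR u) 1 1 (expR_gt0 u) ltr01 ltr01; rewrite !mulr1 => ->.
have s2 : sigma ^+ 2 = Rc 1 1 by rewrite sqr_sqrtr// ltW.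
have s0 : 0 < sigma by rewrite sqrtr_gt0.
rewrite -s2 powR_expR.
have h : expR (- (rho * u)) * expR (- (rho * u)) * expR (2 * rho * u) = 1.
  by rewrite -!expRD (_ : _ + 2 * rho * u = 0) ?expR0//; ring.
rewrite -[RHS]h; move: (expR (- (rho * u))) (expR (2 * rho * u)) => x y.
by field; rewrite gt_eqF.
Qed.

Lemma normalized_exp (u m : R) : 0 < Rc 1 1 ->
  has_expectation _ _ _ P (fun w => expR (m * comb X (nV u) w)) (expR (m ^+ 2 / 2)).
Proof.
move=> Rc0.
have gV : centered_gaussian_rv P (comb X (nV u)).
  by apply: comb_gaussian => //=; rewrite expR_ge0.
apply: has_expectation_ge0.
- apply: measurableT_comp => //; apply: measurable_funM => //.
  by case: gV.
- by move=> w; exact: expR_ge0.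
rewrite (gaussian_mgf _ _ _ _ _ 1)//; first by rewrite mulr1.
by rewrite (comb_sqr _ _ _ _ _ _ gX RcE)/= ?expR_ge0// !big_seq1/= -/(r u u) r1.
Qed.

Lemma normalized_pair (u v m : R) : 0 < Rc 1 1 ->
  has_expectation _ _ _ P (fun w => expR (m * (comb X (nV u) w + comb X (nV v) w)))
    (expR (m ^+ 2 * (1 + r u v))).
Proof.
move=> Rc0.
have gV : centered_gaussian_rv P (comb X (nV u ++ nV v)).
  by apply: comb_gaussian => //=; rewrite !expR_ge0.
have VE w : comb X (nV u) w + comb X (nV v) w = comb X (nV u ++ nV v) w.
  by rewrite /comb big_cat.
under eq_fun do rewrite VE.
apply: has_expectation_ge0.
- apply: measurableT_comp => //; apply: measurable_funM => //.
  by case: gV.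
- by move=> w; exact: expR_ge0.
rewrite (gaussian_mgf _ _ _ _ _ (2 * (1 + r u v)))//.
  by congr (expR _)%:E; field.
rewrite (comb_sqr _ _ _ _ _ _ gX RcE)/= ?expR_ge0//.
rewrite !big_cons !big_nil/= -/(r u u) -/(r u v) -/(r v u) -/(r v v).
by rewrite !r1// (rC v u); congr EFin; ring.
Qed.

(** By self-similarity [r u v] depends only on v - u and equals sigma^-2 h(expR (v - u)), with h the
    function in the decay hypothesis. Logarithmic decay of h is thus power decay in the time
    difference. *)
Lemma correlation_decay : 0 < Rc 1 1 -> exists (C : R) (M0 : nat), 0 <= C /\
  forall (M : nat) (u v : R), (M0 <= M)%N -> u + M%:R <= v ->
    r u v <= C * expR (- (eta * ln M%:R)).
Proof.
move=> Rc0; have [C [M0 [M01 CM]]] := decay.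
have s0 : 0 < sigma by rewrite sqrtr_gt0.
exists (sigma^-1 * sigma^-1 * `|C|), (Num.truncn (Num.max 1 M0)).+1; split.
  by rewrite !mulr_ge0// invr_ge0 ltW.
move=> M u v M0M uv.
have MM0 : Num.max 1 M0 < M%:R.
  by apply: lt_le_trans (truncnS_gt _) _; rewrite ler_nat.
have [M1 M2] : 1 < M%:R :> R /\ M0 < M%:R by move: MM0; rewrite gt_max => /andP.
have uv' : M%:R <= v - u by lra.
have vu0 : 0 < v - u by lra.
have x0 : M0 <= expR (v - u).
  by apply: le_trans (expR_ge1Dx _); lra.
have := CM _ x0; rewrite powR_expR expRK => h.
have -> : r u v = sigma^-1 * sigma^-1 * (expR (- rho * (v - u)) * Rc 1 (expR (v - u))).
  have e : Rc (expR u) (expR v) = expR (2 * rho * u) * Rc 1 (expR (v - u)).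
    have := Xss (expR u) 1 (expR (v - u)) (expR_gt0 _) ltr01 (expR_gt0 _).
    by rewrite mulr1 -expRD addrC subrK powR_expR.
  rewrite /r e (_ : - rho * (v - u) = - (rho * u) + (- (rho * v) + 2 * rho * u)); last by ring.
  by rewrite !expRD; ring.
rewrite -!mulrA !ler_wpM2l ?invr_ge0 ?(ltW s0)//.
apply: le_trans (ler_norm _) _; apply: le_trans h _.
apply: (@le_trans _ _ (`|C| * (v - u) `^ (- eta))).
  by rewrite ler_wpM2r ?powR_ge0// ler_norm.
rewrite ler_wpM2l// /powR gt_eqF// ler_expR -mulNr !mulNr lerN2 ler_pM2l//.
by rewrite ler_ln// posrE; lra.
Qed.

Let mV u : measurable_fun setT (comb X (nV u)).
Proof. by apply: (comb_measurable _ _ _ _ _ gX) => //=; rewrite expR_gt0. Qed.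

(** With N = M^p, the threshold is (1 - ka) l for l^2 = 2 (1 - 2 ka) ln N. The index is shifted by
    one so that all logarithmic times are at least M, which makes the selected times arbitrarily
    large. *)
Let nomax (ka : R) (p M : nat) := [set w | forall i : 'I_(M ^ p), true ->
  comb X (nV (i.+1 * M)%:R) w <= (1 - ka) * Num.sqrt (2 * (1 - 2 * ka) * p%:R * ln M%:R)].

Let mnomax ka p M : measurable (nomax ka p M).
Proof.
rewrite (_ : nomax _ _ _ = \bigcap_(i in [set: 'I_(M ^ p)])
    [set w | comb X (nV (i.+1 * M)%:R) w <=
      (1 - ka) * Num.sqrt (2 * (1 - 2 * ka) * p%:R * ln M%:R)]).
  by apply: fin_bigcap_measurable => // i _; exact: measurable_set_le.
by apply/seteqP; split=> w h i; [move=> _; exact: h|move=> _; exact: (h i I)].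
Qed.

Lemma nomax_prob (ka : R) (p : nat) : 0 < Rc 1 1 -> 0 < ka -> ka <= 4^-1 -> (0 < p)%N ->
  exists (f : nat -> R) (M0 : nat), f n @[n --> \oo] --> (0 : R) /\
    forall M, (M0 <= M)%N -> (P (nomax ka p M) <= (f M)%:E)%E.
Proof.
move=> Rc0 ka0 ka4 p0.
have [C [M0 [C0 HC]]] := correlation_decay Rc0.
have p0' : 0 < p%:R :> R by rewrite ltr0n.
pose th := 1 - 2 * ka; have th0 : 0 < th by rewrite /th; lra.
(* [c1] is the exponent of M in the truncation error. [c2] comes from (1/2 + ka) l^2 - ln N = ((1 +
   2 ka)(1 - 2 ka) - 1) ln N = - 4 ka^2 ln N. The correlation term is expR of a multiple of M^(-eta)
   ln M, minus 1. *)
pose c1 := ka ^+ 2 * th * p%:R.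
have c10 : 0 < c1 by rewrite !mulr_gt0// exprn_gt0.
pose c2 := 4 * ka ^+ 2 * p%:R.
have c20 : 0 < c2 by rewrite !mulr_gt0// exprn_gt0.
pose a := 2 * th * p%:R * C.
exists (fun n => 4 * expR (- (c1 * ln n%:R)) + expR (- (c2 * ln n%:R)) +
  (expR (a * (ln n%:R * expR (- (eta * ln n%:R)))) - 1)), (maxn 1 M0); split.
  exact: cvg_second_moment_bound.
move=> M; rewrite geq_max => /andP[M1 MM0].
have M_gt0 : 0 < M%:R :> R by rewrite ltr0n.
have lM0 : 0 <= ln M%:R :> R by rewrite ln_ge0// ler1n.
pose l := Num.sqrt (2 * th * p%:R * ln M%:R).
have l2 : l ^+ 2 = 2 * th * p%:R * ln M%:R.
  by rewrite sqr_sqrtr// !mulr_ge0// ltW.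
have N0 : (0 < M ^ p)%N by rewrite expn_gt0 M1.
have cor (i j : 'I_(M ^ p)) : i != j ->
    r (i.+1 * M)%:R (j.+1 * M)%:R <= C * expR (- (eta * ln M%:R)).
  move=> ij; wlog : i j ij / (i < j)%N.
    move=> H; have [/H|ji|e] := ltngtP i j; first exact.
      by rewrite rC; apply: H => //; rewrite eq_sym.
    by move: ij; rewrite (val_inj e) eqxx.
  move=> lij; apply: HC => //.
  by rewrite -natrD ler_nat -mulSnr leq_mul2r ltnS lij orbT.
have := @truncated_second_moment _ _ _ P (M ^ p)%N
  (fun i => comb X (nV (i.+1 * M)%:R)) l ka (C * expR (- (eta * ln M%:R)))
  (fun i j => expR (l ^+ 2 * (1 + r (i.+1 * M)%:R (j.+1 * M)%:R)))
  N0 (fun i => mV _) (sqrtr_ge0 _) ka0 _ (fun i m => normalized_exp _ m Rc0)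
  (fun i j _ => normalized_pair _ _ l Rc0) _.
move=> /(_ ltac:(lra)) H; apply: le_trans (H _) _.
  by move=> i j ij; rewrite ler_expR ler_wpM2l ?sqr_ge0// lerD2l; exact: cor.
rewrite lee_fin l2 lerD//.
  rewrite lerD//.
    by rewrite /c1 (_ : ka ^+ 2 * _ / 2 = ka ^+ 2 * th * p%:R * ln M%:R)//; field.
  have -> : (M ^ p)%:R = expR (p%:R * ln M%:R) :> R.
    by rewrite natrX mulr_natl -lnXn// lnK// posrE exprn_gt0.
  rewrite -expRN -expRD ler_expR /c2 /th; nra.
by rewrite lerD2r ler_expR /a; lra.
Qed.

Lemma lil_lower_pos (L : R) : 0 < Rc 1 1 -> L < sigma ->
  {ae P, forall w, forall S, exists2 s, S <= s & L * lil_norm rho s <= X s w}.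
Proof.
move=> Rc0 Ls.
have s0 : 0 < sigma by rewrite sqrtr_gt0.
(* The bound ka <= (sigma - L) / (3 sigma) gives sigma (1 - ka)(1 - 2 ka) >= sigma - 3 sigma ka >=
   L; the other bound keeps 1 - 2 ka positive. *)
pose ka := Num.min 4^-1 ((sigma - L) / (3 * sigma)).
have ka0 : 0 < ka by rewrite lt_min invr_gt0 ltr0n/= divr_gt0// ?subr_gt0// mulr_gt0.
have ka4 : ka <= 4^-1 by rewrite ge_min lexx.
have kaL : L <= sigma * (1 - ka) * (1 - 2 * ka).
  have : ka <= (sigma - L) / (3 * sigma) by rewrite ge_min lexx orbT.
  rewrite ler_pdivlMr ?mulr_gt0// => h.
  have : 0 <= sigma * ka ^+ 2 by rewrite mulr_ge0 ?sqr_ge0// ltW.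
  by lra.
(* With p >= 1 / ka, the factor 1 - 2 ka absorbs the ratio of (p + 1) ln M, which bounds the
   logarithm of the largest time, to p ln M = ln N. *)
pose p := (Num.truncn ka^-1).+1.
have pka : 1 <= ka * p%:R.
  by rewrite mulrC -ler_pdivrMr// mul1r ltW// truncnS_gt.
pose th := 1 - 2 * ka; have th0 : 0 < th by rewrite /th; lra.
have thp : th * (p%:R + 1) <= p%:R by rewrite /th; lra.
have [f [M0 [f0 HM0]]] := nomax_prob ka p Rc0 ka0 ka4 isT.
have ae_m (m : nat) : {ae P, forall w, exists2 M, (m <= M)%N & ~ nomax ka p M w}.
  (* The event that all M >= m fail is contained in each single failure event, whose probability
     tends to 0, so it is null. Intersecting over [m] gives infinitely many successful M. *)
  exists (\bigcap_(M in [set M | (m <= M)%N]) nomax ka p M); split.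
  - by apply: bigcap_measurable => //; exists m => /=.
  - set B := \bigcap_(_ in _) _.
    have mB : measurable B by apply: bigcap_measurable => //; exists m => /=.
    apply/eqP; rewrite eq_le measure_ge0 andbT.
    apply/lee_addgt0Pr => e e0; rewrite add0e.
    have /cvgrPdist_lt/(_ e e0)[M1 _ HM1] := f0.
    pose M := maxn m (maxn M0 M1).
    apply: (@le_trans _ _ (P (nomax ka p M))).
      apply: le_measure; rewrite ?inE// => w; apply; rewrite /= /M leq_max leqnn//.
    apply: le_trans (HM0 M _) _; first by rewrite /M !leq_max leqnn !orbT.
    rewrite lee_fin; have /= := HM1 M; rewrite /M !leq_max leqnn !orbT => /(_ isT).
    by rewrite sub0r normrN => /ltr_normlW /ltW.
  - move=> w /= h M mM; apply: contrapT => hM; apply: h; by exists M.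
have := ae_foralln ae_m.
apply: filterS => w H S.
pose m := maxn 2 (Num.truncn S).+1.
have [M mM /existsNP[i /not_implyP[_ /negP]]] := H m.
rewrite -ltNge nVE => hV.
have [M2 MS] : (2 <= M)%N /\ (Num.truncn S < M)%N.
  by move: mM; rewrite geq_max => /andP.
pose u : R := (i.+1 * M)%:R; exists (expR u).
  have : S <= M%:R.
    by apply: le_trans (ltW (truncnS_gt S)) _; rewrite ler_nat.
  move=> SM; apply: le_trans SM _; apply: (@le_trans _ _ u).
    by rewrite ler_nat leq_pmull.
  by apply: le_trans (expR_ge1Dx u); rewrite lerDr.
have M0' : 0 < M%:R :> R by rewrite ltr0n; exact: leq_trans M2.
have lnM : 0 <= ln M%:R :> R by rewrite ln_ge0// ler1n; exact: leq_trans M2.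
have u1 : 1 <= u by rewrite ler1n muln_gt0/=; exact: leq_trans M2.
have lnu : ln u <= (p%:R + 1) * ln M%:R.
  have : u <= M%:R ^+ p.+1.
    rewrite -natrX ler_nat expnS mulnC leq_mul2l ltn_ord orbT//.
  rewrite -(ler_ln _ _) ?posrE ?exprn_gt0//; last by lra.
  by by rewrite lnXn// -[ln M%:R *+ _]mulr_natl -[p.+1%:R]natr1.
have lnu0 : 0 <= ln u by exact: ln_ge0.
rewrite lil_normE ?expR_ge0// expRK.
set q := Num.sqrt (2 * ln u).
have q0 : 0 <= q by exact: sqrtr_ge0.
have hq : th * q <= Num.sqrt (2 * (1 - 2 * ka) * p%:R * ln M%:R).
  rewrite -/th -(@ler_sqr R) ?nnegrE ?sqrtr_ge0 ?mulr_ge0 ?(ltW th0)//.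
  rewrite exprMn !sqr_sqrtr ?mulr_ge0 ?(ltW th0)//.
  have h1 : th * ln u <= p%:R * ln M%:R.
    apply: le_trans (ler_wpM2l (ltW th0) lnu) _.
    by rewrite mulrA ler_wpM2r.
  have := ler_wpM2l (ltW th0) h1; lra.
have {}hV : (1 - ka) * (th * q) <= sigma^-1 * expR (- (rho * u)) * X (expR u) w.
  apply: le_trans (ltW hV); rewrite ler_wpM2l//; lra.
rewrite powR_expR.
have {}hV : sigma * expR (rho * u) * ((1 - ka) * (th * q)) <= X (expR u) w.
  rewrite expRN -invfM mulrC -ler_pdivrMl ?invr_gt0 ?mulr_gt0 ?expR_gt0// in hV.
  by move: hV; rewrite invrK [(1 - ka) * _]mulrC.
apply: le_trans hV.
rewrite -/th in kaL.
have := ler_wpM2r (mulr_ge0 (expR_ge0 (rho * u)) q0) kaL.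
by move: (expR (rho * u)) => z; lra.
Qed.

End lower_bound.

(** * The law of the iterated logarithm *)

Section limsup.
Context {R : realType}.

Lemma lil_norm_gt0 (rho s : R) : expR (expR 1) <= s -> 0 < lil_norm rho s.
Proof.
move=> hs; have s0 : 0 < s by apply: lt_le_trans hs; exact: expR_gt0.
have := le_lnln _ _ hs => h.
by rewrite lil_normE ?ltW// mulr_gt0 ?powR_gt0// sqrtr_gt0; lra.
Qed.

Lemma limsup_pinfty_eq (f g : R -> R) (l : R) :
  (exists S0, forall s, S0 <= s -> 0 < g s) ->
  (forall n, exists S, forall s, S <= s -> f s <= (l + n.+1%:R^-1) * g s) ->
  (forall n S, exists2 s, S <= s & (l - n.+1%:R^-1) * g s <= f s) ->
  limsup_pinfty (fun s => f s / g s) = l%:E.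
Proof.
move=> [S0 g0] up lo.
have small (e : R) : 0 < e -> exists n, n.+1%:R^-1 <= e.
  move=> e0; exists (Num.truncn e^-1).
  by rewrite invf_ple ?posrE// ltW// truncnS_gt.
apply/eqP; rewrite eq_le; apply/andP; split.
  apply/lee_addgt0Pr => e /small[n ne]; have [S hS] := up n.
  apply: (@le_trans _ _ (l + n.+1%:R^-1)%:E); last first.
    by rewrite -EFinD lee_fin lerD2l.
  apply: (@le_trans _ _ (ereal_sup [set (f s / g s)%:E | s in [set s | Num.max S S0 < s]])).
    apply: ereal_inf_lbound; exists [set s | Num.max S S0 < s] => //.
    by exists (Num.max S S0); rewrite num_real.
  apply: ge_ereal_sup => _ [s + <-]; rewrite /= gt_max => /andP[Ss S0s].
  by rewrite lee_fin ler_pdivrMr ?(g0 _ (ltW S0s))// hS ?(ltW Ss).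
apply: le_ereal_inf_tmp => _ [V [M [_ MV]] <-].
apply/lee_subgt0Pr => e /small[n ne].
(* Neighborhoods of infinity are given by strict inequalities, hence M + 1. *)
have [s] := lo n (Num.max (M + 1) S0); rewrite ge_max => /andP[Ms S0s] hs.
apply: (@le_trans _ _ (f s / g s)%:E); last first.
  apply: ereal_sup_ubound; exists s => //; apply: MV.
  by apply: lt_le_trans Ms; rewrite ltrDl.
rewrite -EFinB lee_fin ler_pdivlMr ?g0//; apply: le_trans hs.
by rewrite ler_wpM2r ?(ltW (g0 _ _))// lerD2l lerN2.
Qed.

End limsup.

Section lil.
Context {d} {T : measurableType d} {R : realType} (P : probability T R)
  (X : R -> T -> R) (Rc : R -> R -> R) (rho eta : R).
Hypotheses (gX : centered_gaussian_process P X)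
  (cX : forall w, {within `[0, +oo[%classic, continuous (fun s => X s w)})
  (RcE : forall s t, 0 <= s -> 0 <= t -> (Rc s t)%:E = ('E_P[X s \* X t])%E)
  (rho0 : 0 < rho)
  (Xss : forall c s t, 0 < c -> 0 < s -> 0 < t ->
     Rc (c * s) (c * t) = c `^ (2 * rho) * Rc s t)
  (eta0 : 0 < eta)
  (decay : exists C M : R, 1 <= M /\ forall x, M <= x ->
     `| x `^ (- rho) * Rc 1 x| <= C * (ln x) `^ (- eta)).
Let sigma := Num.sqrt (Rc 1 1).

Lemma process_degenerate (s : R) : Rc 1 1 = 0 -> 0 < s ->
  {ae P, forall w, X s w = 0}.
Proof.
move=> Rc0 s0; have mX := process_measurable _ _ _ _ _ gX _ (ltW s0).
have : (\int[P]_(w in setT) `|(X s w ^+ 2)%:E| = 0)%E.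
  under eq_integral do rewrite gee0_abs ?lee_fin ?sqr_ge0//.
  by rewrite (process_sqr _ _ _ _ _ _ _ gX RcE Xss _ s0) Rc0 mulr0.
have mX2 : measurable_fun setT (fun w => (X s w ^+ 2)%:E).
  by apply/measurable_EFinP; exact: measurable_funX.
move=> /(ae_eq_integral_abs P measurableT mX2).
by apply: filterS => w /(_ I)[] /eqP; rewrite sqrf_eq0 => /eqP.
Qed.

Lemma lil_lower (L : R) : L < sigma ->
  {ae P, forall w, forall S, exists2 s, S <= s & L * lil_norm rho s <= X s w}.
Proof.
move=> Ls; have := Rc11_ge0 _ _ _ _ _ _ _ gX RcE Xss.
rewrite le_eqVlt => /predU1P[/esym Rc0|Rc0]; last first.
  exact: (lil_lower_pos _ _ _ _ _ _ _ _ gX RcE Xss eta0 decay).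
(* If sigma = 0 no normalization is possible, but the process almost surely vanishes at all positive
   integers, while [L * lil_norm rho s] is at most 0. *)
have L0 : L < 0 by move: Ls; rewrite /sigma Rc0 sqrtr0.
have ae0 (n : nat) : {ae P, forall w, X n.+1%:R w = 0}.
  exact: process_degenerate.
have := ae_foralln ae0; apply: filterS => w H S.
exists (Num.truncn S).+1%:R; first exact/ltW/truncnS_gt.
by rewrite H mulr_le0_ge0 ?sqrtr_ge0// ltW.
Qed.

Lemma lil : {ae P, forall w,
  limsup_pinfty (fun s => X s w / lil_norm rho s) = sigma%:E}.
Proof.
have up (n : nat) : {ae P, forall w, exists S : R, forall s : R, S <= s ->
    X s w <= (sigma + n.+1%:R^-1) * lil_norm rho s}.
  by apply: (lil_upper _ _ _ _ _ _ _ gX cX RcE rho0 Xss); rewrite ltrDl.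
have lo (n : nat) : {ae P, forall w, forall S, exists2 s, S <= s &
    (sigma - n.+1%:R^-1) * lil_norm rho s <= X s w}.
  by apply: lil_lower; rewrite ltrBlDr ltrDl.
have := ae_foralln up; apply: filterS2 (ae_foralln lo) => w hlo hup.
apply: limsup_pinfty_eq => //.
by exists (expR (expR 1)) => s; exact: lil_norm_gt0.
Qed.

End lil.

Lemma centered_gaussian_processN {d} {T : measurableType d} {R : realType}
    (P : probability T R) (X : R -> T -> R) :
  centered_gaussian_process P X ->
  centered_gaussian_process P (fun s w => - X s w).
Proof.
move=> gX n s a s0; have := gX n s (fun i => - a i) s0.
by congr (centered_gaussian_rv P _); apply/funext => w; apply: eq_bigr => i _; rewrite mulrN mulNr.
Qed.

Theorem theorem1p2 (d : measure_display) (T : measurableType d) (R : realType)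
  (P : probability T R) (X : R -> T -> R) (Rc : R -> R -> R) (rho eta : R) :
  centered_gaussian_process P X ->
  (forall w, {within `[0, +oo[%classic, continuous (fun s => X s w)}) ->
  (forall s t, 0 <= s -> 0 <= t -> (Rc s t)%:E = ('E_P[X s \* X t])%E) ->
  0 < rho ->
  (forall c s t, 0 < c -> 0 < s -> 0 < t ->
     Rc (c * s) (c * t) = c `^ (2 * rho) * Rc s t) ->
  0 < eta ->
  (exists C M : R, 1 <= M /\ forall x, M <= x ->
     `| x `^ (- rho) * Rc 1 x | <= C * (ln x) `^ (- eta)) ->
  {ae P, forall w,
     limsup_pinfty (fun s => X s w / lil_norm rho s) = (Num.sqrt (Rc 1 1))%:E} /\
  {ae P, forall w,
     limsup_pinfty (fun s => - X s w / lil_norm rho s) = (Num.sqrt (Rc 1 1))%:E}.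
Proof.
move=> gX cX RcE rho0 Xss eta0 decay; split.
  exact: (lil _ _ _ _ _ gX cX RcE rho0 Xss eta0 decay).
apply: (lil _ _ _ _ _ (centered_gaussian_processN _ _ gX) _ _ rho0 Xss eta0 decay).
- by move=> w s; apply: continuousN; exact: cX.
- move=> s t s0 t0; rewrite RcE//; congr ('E_P[_])%E.
  by apply/funext => w /=; rewrite mulrNN.
Qed.
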